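(* Let $q$ be a power of a prime $p$, $n\ge2$, $s\ge2$, $1\le k\le n-1$ integers, $\sigma$ a generator of $\mathrm{Gal}(\mathbb F_{q^n}/\mathbb F_q)$, $F\in\mathbb F_q[Y]$ a monic irreducible polynomial of degree $s$, and let $\mathbb F=\mathbb F_{q^s}$. The projection $$\pi:\mathrm{Aut}(\mathcal C_k(F))\longrightarrow\mathrm{Aut}_{\mathbb F_p}(\mathbb F),\qquad (M,N,\rho)\longmapsto\rho$$ has image $\mathcal H_F$, and its kernel is canonically isomorphic to $\mathrm{Aut}_{\mathbb E}(\mathcal C_k(F))$ (via $(M,N)\mapsto(M,N,\mathrm{id})$). Hence there is a short exact sequence $$1\longrightarrow\mathrm{Aut}_{\mathbb E}(\mathcal C_k(F))\longrightarrow\mathrm{Aut}(\mathcal C_k(F))\overset{\pi}{\longrightarrow}\mathcal H_F\longrightarrow1.$$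
   Context: Set-up. Let $\ell=\gcd(n,s)$, $n'=n/\ell$, $\mathbb K=\mathbb F_{q^n}$, $\mathbb L=\mathbb F_{q^{ns/\ell}}$, $\mathbb F=\mathbb F_{q^s}$, $V=\mathbb L^\ell$. Write $\sigma:\alpha\mapsto\alpha^{q^h}$ with $\gcd(h,n)=1$, and extend $\sigma$ to $\mathbb L$ by the same formula. Choose integers $c>0$, $c'$ with $\ell=cs+c'n$ and $\gcd(c,n')=1$, and put $\gamma:\mathbb L\to\mathbb L$, $\gamma(\alpha)=\alpha^{q^{hcs}}$, a generator of $\mathrm{Gal}(\mathbb L/\mathbb F)$. $V$ is an $s$-dimensional $\mathbb K$-vector space via $\alpha\cdot(x_0,\dots,x_{\ell-1})=(\alpha x_0,\alpha^{\sigma}x_1,\dots,\alpha^{\sigma^{\ell-1}}x_{\ell-1})$. For $w\in\mathbb L^\times$ let $T_{w,\sigma}(x_0,\dots,x_{\ell-1})=(x_1,\dots,x_{\ell-1},w x_0^\gamma)$; it is additive and $\sigma$-semilinear over $\mathbb K$, and $T_{w,\sigma}^n=\mathrm N_{\mathbb L/\mathbb F}(w)\,\mathrm{id}_V$ (coordinatewise multiplication). Fix $w_F\in\mathbb L^\times$ such that $u_F:=\mathrm N_{\mathbb L/\mathbb F}(w_F)$ is a root of $F$, and set $T_F:=T_{w_F,\sigma}$. Let $\mathbb E:=\mathbb F\,\mathrm{id}_V=\mathbb F_q[T_F^n]$ (coordinatewise multiplications by elements of $\mathbb F$), identified with $\mathbb F$; $V$ is an $n$-dimensional $\mathbb E$-vector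 space. The code is $$\mathcal C_k(F):=\Big\{\sum_{i=0}^{sk-1}\alpha_i\cdot T_F^i:\alpha_i\in\mathbb K\Big\}\subseteq\mathrm{End}_{\mathbb E}(V).$$ Fix an $\mathbb E$-basis of $V$; for $\rho\in\mathrm{Aut}_{\mathbb F_p}(\mathbb E)$ let $L_\rho$ be the $\rho$-semilinear map fixing the basis vectors, and put $A^\rho:=L_\rho AL_\rho^{-1}$ and $\mathcal D^\rho:=\{A^\rho:A\in\mathcal D\}$ for $A\in\mathrm{End}_{\mathbb E}(V)$, $\mathcal D\subseteq\mathrm{End}_{\mathbb E}(V)$ (equivalently, $\rho$ acts entrywise on matrices). Define $$\mathrm{Aut}(\mathcal C_k(F)):=\{(M,N,\rho)\in\mathrm{GL}_{\mathbb E}(V)\times\mathrm{GL}_{\mathbb E}(V)\times\mathrm{Aut}_{\mathbb F_p}(\mathbb E):M\,\mathcal C_k(F)^\rho\,N=\mathcal C_k(F)\},$$ with group law $(M,N,\rho)(M',N',\rho')=(MM'^{\rho},N'^{\rho}N,\rho\rho')$, and $$\mathrm{Aut}_{\mathbb E}(\mathcal C_k(F)):=\{(M,N)\in\mathrm{GL}_{\mathbb E}(V)^2:M\,\mathcal C_k(F)\,N=\mathcal C_k(F)\}.$$ $\mathcal H_F^+:=\{\rho\in\mathrm{Aut}_{\mathbb F_p}(\mathbb F):\rho(u_F)=\lambda u_F\text{ for some }\lambda\in\mathbb F_q^\times\}$; for $n=2$, $\mathcal H_F^-:=\{\rho\in\mathrm{Aut}_{\mathbb F_p}(\mathbb F):\rho(u_F)=\lambda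 u_F^{-1}\text{ for some }\lambda\in\mathbb F_q^\times\}$. Finally $\mathcal H_F:=\mathcal H_F^+$ if $n>2$ and $\mathcal H_F:=\mathcal H_F^+\cup\mathcal H_F^-$ if $n=2$. *)

(* Defs.v *)
From HB Require Import structures.
From mathcomp Require Import all_boot all_order all_algebra.
From mathcomp Require Import all_fingroup all_solvable all_field.
From mathcomp Require Import boolp classical_sets.

Set Implicit Arguments.
Unset Strict Implicit.
Unset Printing Implicit Defensive.

Import GRing.Theory.
Local Open Scope classical_set_scope.
Local Open Scope ring_scope.

Section GeneralLinear.
Variables (F0 : fieldType) (V : vectType F0).

Record gl := GL { glval :> 'End(V); gl_proof : lker glval == 0%VS }.
HB.instance Definition _ := [isSub for glval].
HB.instance Definition _ := [Choice of gl by <:].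

Lemma gl_one_proof : lker (\1%VF : 'End(V)) == 0%VS.
Proof. by apply/lker0P => x y; rewrite !id_lfunE. Qed.

Lemma gl_mul_proof (M N : gl) : lker (M \o N)%VF == 0%VS.
Proof.
apply/lker0P => x y; rewrite !comp_lfunE => e.
exact: (lker0P (gl_proof N)) ((lker0P (gl_proof M)) _ _ e).
Qed.

Lemma gl_inv_proof (M : gl) : lker (M^-1)%VF == 0%VS.
Proof.
by apply/lker0P => x y /(congr1 M); rewrite !lker0_lfunVK ?gl_proof.
Qed.

Definition gl_one := GL gl_one_proof.
Definition gl_mul M N := GL (gl_mul_proof M N).
Definition gl_inv M := GL (gl_inv_proof M).

Fact gl_mulA : associative gl_mul.
Proof. by move=> x y z; apply: val_inj; rewrite /= comp_lfunA. Qed.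
Fact gl_mul1g : left_id gl_one gl_mul.
Proof. by move=> x; apply: val_inj; rewrite /= comp_lfun1l. Qed.
Fact gl_mulg1 : right_id gl_one gl_mul.
Proof. by move=> x; apply: val_inj; rewrite /= comp_lfun1r. Qed.
Fact gl_mulVg : left_inverse gl_one gl_inv gl_mul.
Proof. by move=> x; apply: val_inj; rewrite /= lker0_compVf ?gl_proof. Qed.
Fact gl_mulgV : right_inverse gl_one gl_inv gl_mul.
Proof. by move=> x; apply: val_inj; rewrite /= lker0_compfV ?gl_proof. Qed.
HB.instance Definition _ :=
  isGroup.Build gl gl_mulA gl_mul1g gl_mulg1 gl_mulVg gl_mulgV.

(* Pairs (M, N) acting on 'End(V) by A |-> M A N; since the second factor acts
   on the right, the group law is (M, N)(M', N') = (M M', N' N). *)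
Record glpair := GLPair { lpart : gl; rpart : gl }.

Lemma glpairK :
  cancel (fun g => (lpart g, rpart g)) (fun x => GLPair x.1 x.2).
Proof. by case. Qed.
HB.instance Definition _ := Choice.copy glpair (can_type glpairK).

Definition glpair_one := GLPair 1%g 1%g.
Definition glpair_mul g g' :=
  GLPair (lpart g * lpart g')%g (rpart g' * rpart g)%g.
Definition glpair_inv g := GLPair (lpart g)^-1%g (rpart g)^-1%g.

Fact glpair_mulA : associative glpair_mul.
Proof. by move=> x y z; rewrite /glpair_mul /= !mulgA. Qed.
Fact glpair_mul1g : left_id glpair_one glpair_mul.
Proof. by case=> M N; rewrite /glpair_mul /= mul1g mulg1. Qed.
Fact glpair_mulg1 : right_id glpair_one glpair_mul.
Proof. by case=> M N; rewrite /glpair_mul /= mul1g mulg1. Qed.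
Fact glpair_mulVg : left_inverse glpair_one glpair_inv glpair_mul.
Proof. by case=> M N; rewrite /glpair_mul /= mulVg mulgV. Qed.
Fact glpair_mulgV : right_inverse glpair_one glpair_inv glpair_mul.
Proof. by case=> M N; rewrite /glpair_mul /= mulVg mulgV. Qed.
HB.instance Definition _ := isGroup.Build glpair
  glpair_mulA glpair_mul1g glpair_mulg1 glpair_mulVg glpair_mulgV.

Definition lact (g : glpair) (C : set 'End(V)) : set 'End(V) :=
  [set (lpart g \o A \o rpart g)%VF | A in C].

Lemma lact1 C : lact 1%g C = C.
Proof.
rewrite -[RHS]image_id; apply: eq_imagel => A _ /=.
by rewrite comp_lfun1l comp_lfun1r.
Qed.

Lemma lactM g g' C : lact (g * g')%g C = lact g (lact g' C).
Proof.
rewrite /lact image_comp; apply: eq_imagel => A _ /=.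
by rewrite !comp_lfunA.
Qed.

Variable C : set 'End(V).

Record laut := LAut { laut_val :> glpair; _ : `[< lact laut_val C = C >] }.
HB.instance Definition _ := [isSub for laut_val].
HB.instance Definition _ := [Choice of laut by <:].

Lemma laut_closed : group_closed (fun g => `[< lact g C = C >]).
Proof.
split=> [|g g']; first by apply/asboolP; exact: lact1.
move=> /asboolP gC /asboolP g'C; apply/asboolP.
by rewrite lactM -{1}g'C -(lactM _ g') mulVg lact1.
Qed.
HB.instance Definition _ := SubChoice_isSubGroup.Build _ _ laut laut_closed.

End GeneralLinear.

Arguments glpair {F0} V.

Section SemilinearAction.
Variables (F0 : fieldType) (L : splittingFieldType F0) (E : {subfield L}).

(* [gal_of E] is the group of all automorphisms of E over the base field F0,
   but its elements are coerced to endomorphisms of L; only their restriction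
   to E is canonical. *)
Definition autE (rho : gal_of E) (a : subvs_of E) : subvs_of E :=
  vsproj E (rho (vsval a)).

Lemma autEK rho a : vsval (autE rho a) = rho (vsval a).
Proof. by rewrite vsprojK // memv_gal ?subvsP. Qed.

Lemma autED rho : {morph autE rho : a b / a + b}.
Proof. by move=> a b; apply: val_inj; rewrite /= !autEK /= !linearD. Qed.

Lemma autEM rho : {morph autE rho : a b / a * b}.
Proof. by move=> a b; apply: val_inj; rewrite /= !autEK /= rmorphM. Qed.

Lemma autE0 rho : autE rho 0 = 0.
Proof. by apply: val_inj; rewrite /= autEK /= linear0. Qed.

Lemma autE1 rho : autE rho 1 = 1.
Proof. by apply: val_inj; rewrite /= autEK /= algid1 rmorph1. Qed.

Lemma autE_id a : autE 1%g a = a.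
Proof. by apply: val_inj; rewrite /= autEK gal_id. Qed.

Lemma autE_comp rho rho' a : autE (rho' * rho)%g a = autE rho (autE rho' a).
Proof. by apply: val_inj; rewrite /= !autEK galM // subvsP. Qed.

Variables (V : vectType (subvs_of E)) (n : nat) (b : n.-tuple V).

(* the rho-semilinear map L_rho fixing the vectors of b *)
Definition semilin (rho : gal_of E) (v : V) : V :=
  \sum_(i < n) autE rho (coord b i v) *: b`_i.

Lemma semilinD rho : {morph semilin rho : u v / u + v}.
Proof.
move=> u v; rewrite /semilin -big_split; apply: eq_bigr => i _ /=.
by rewrite linearD autED scalerDl.
Qed.

Lemma semilinZ rho a v : semilin rho (a *: v) = autE rho a *: semilin rho v.
Proof.
rewrite /semilin scaler_sumr; apply: eq_bigr => i _.
by rewrite linearZ autEM scalerA.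
Qed.

Definition twist_fun (rho : gal_of E) (A : 'End(V)) (v : V) : V :=
  semilin rho (A (semilin rho^-1%g v)).

Fact twist_is_linear rho A : linear (twist_fun rho A).
Proof.
move=> a u v; rewrite /twist_fun semilinD semilinZ linearD linearZ.
by rewrite semilinD semilinZ -autE_comp mulVg autE_id.
Qed.
HB.instance Definition _ rho A := GRing.isLinear.Build _ _ _ _
  (twist_fun rho A) (twist_is_linear rho A).

(* A^rho = L_rho A L_rho^-1 *)
Definition twist (rho : gal_of E) (A : 'End(V)) : 'End(V) :=
  linfun (twist_fun rho A).

Lemma twistE rho A v : twist rho A v = semilin rho (A (semilin rho^-1%g v)).
Proof. by rewrite lfunE. Qed.

Hypothesis bV : basis_of fullv b.

Lemma semilin_basis rho (i : 'I_n) : semilin rho b`_i = b`_i.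
Proof.
rewrite /semilin (bigD1 i) //= coord_free ?(basis_free bV) // eqxx.
rewrite autE1 scale1r big1 ?addr0 // => j ne_ji.
by rewrite coord_free ?(basis_free bV) // eq_sym (negPf ne_ji) autE0 scale0r.
Qed.

Lemma semilin_coord rho i v : coord b i (semilin rho v) = autE rho (coord b i v).
Proof. by rewrite /semilin coord_sum_free ?(basis_free bV). Qed.

Lemma semilin1 v : semilin 1%g v = v.
Proof.
rewrite [RHS](coord_basis bV (memvf v)); apply: eq_bigr => i _.
by rewrite autE_id.
Qed.

Lemma semilin_comp rho rho' v :
  semilin (rho' * rho)%g v = semilin rho (semilin rho' v).
Proof.
rewrite {1 2}/semilin; apply: eq_bigr => i _.
by rewrite semilin_coord autE_comp.
Qed.

Lemma twist1 A : twist 1%g A = A.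
Proof. by apply/lfunP => v; rewrite twistE invg1 !semilin1. Qed.

Lemma twist_comp rho rho' A : twist (rho' * rho)%g A = twist rho (twist rho' A).
Proof. by apply/lfunP => v; rewrite !twistE invMg !semilin_comp. Qed.

Lemma twistM rho A B : twist rho (A \o B)%VF = (twist rho A \o twist rho B)%VF.
Proof.
apply/lfunP => v; rewrite comp_lfunE !twistE comp_lfunE.
by rewrite -semilin_comp mulgV semilin1.
Qed.

Lemma twist_id rho : twist rho \1%VF = \1%VF.
Proof.
by apply/lfunP => v; rewrite twistE !id_lfunE -semilin_comp mulVg semilin1.
Qed.

Lemma gl_twist_proof rho (M : gl V) : lker (twist rho M) == 0%VS.
Proof.
apply/lker0P => u v e.
have : (twist rho M^-1%g \o twist rho M)%VF u =
       (twist rho M^-1%g \o twist rho M)%VF v by rewrite !comp_lfunE e.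
by rewrite -twistM /= lker0_compVf ?gl_proof // twist_id !id_lfunE.
Qed.

Definition gl_twist rho M := GL (gl_twist_proof rho M).

Lemma gl_twistM rho M N : gl_twist rho (M * N)%g = (gl_twist rho M * gl_twist rho N)%g.
Proof. by apply: val_inj; rewrite /= twistM. Qed.

Lemma gl_twist1 rho : gl_twist rho 1%g = 1%g.
Proof. by apply: val_inj; rewrite /= twist_id. Qed.

Lemma gl_twist_1 M : gl_twist 1%g M = M.
Proof. by apply: val_inj; rewrite /= twist1. Qed.

Lemma gl_twist_comp rho rho' M :
  gl_twist (rho' * rho)%g M = gl_twist rho (gl_twist rho' M).
Proof. by apply: val_inj; rewrite /= twist_comp. Qed.

End SemilinearAction.

Section SemilinearGroup.
Variables (F0 : fieldType) (L : splittingFieldType F0) (E : {subfield L}).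
Variables (V : vectType (subvs_of E)) (n : nat) (b : n.-tuple V).

Record semitriple (bV : basis_of fullv b) :=
  SemiTriple { st_M : gl V; st_N : gl V; st_rho : gal_of E }.

Variable bV : basis_of fullv b.

Lemma semitripleK :
  cancel (fun g : semitriple bV => (st_M g, st_N g, st_rho g))
         (fun x => SemiTriple bV x.1.1 x.1.2 x.2).
Proof. by case. Qed.
HB.instance Definition _ := Choice.copy (semitriple bV) (can_type semitripleK).

(* (M, N, rho)(M', N', rho') = (M M'^rho, N'^rho N, rho o rho'); the product in
   [gal_of E] composes automorphisms from left to right, so that the composite
   rho o rho' is [rho' * rho]. *)
Definition st_one := SemiTriple bV 1%g 1%g 1%g.
Definition st_mul (g g' : semitriple bV) := SemiTriple bV
  (st_M g * gl_twist bV (st_rho g) (st_M g'))%g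
  (gl_twist bV (st_rho g) (st_N g') * st_N g)%g
  (st_rho g' * st_rho g)%g.
Definition st_inv (g : semitriple bV) := SemiTriple bV
  (gl_twist bV (st_rho g)^-1 (st_M g)^-1)%g
  (gl_twist bV (st_rho g)^-1 (st_N g)^-1)%g
  (st_rho g)^-1%g.

Fact st_mulA : associative st_mul.
Proof. by move=> x y z; rewrite /st_mul /= !gl_twistM !gl_twist_comp !mulgA. Qed.
Fact st_mul1g : left_id st_one st_mul.
Proof. by case=> M N r; rewrite /st_mul /= !gl_twist_1 mul1g !mulg1. Qed.
Fact st_mulg1 : right_id st_one st_mul.
Proof. by case=> M N r; rewrite /st_mul /= !gl_twist1 !mul1g mulg1. Qed.
Fact st_mulVg : left_inverse st_one st_inv st_mul.
Proof.
case=> M N r; rewrite /st_mul /= -!gl_twistM mulVg !mulgV !gl_twist1.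
by [].
Qed.
Fact st_mulgV : right_inverse st_one st_inv st_mul.
Proof.
case=> M N r; rewrite /st_mul /= -!gl_twist_comp mulVg !gl_twist_1.
by rewrite mulgV mulVg.
Qed.
HB.instance Definition _ := isGroup.Build (semitriple bV)
  st_mulA st_mul1g st_mulg1 st_mulVg st_mulgV.

(* M C^rho N *)
Definition sact (g : semitriple bV) (C : set 'End(V)) : set 'End(V) :=
  [set (st_M g \o twist b (st_rho g) A \o st_N g)%VF | A in C].

Lemma sact1 C : sact 1%g C = C.
Proof.
rewrite -[RHS]image_id; apply: eq_imagel => A _ /=.
by rewrite twist1 // comp_lfun1l comp_lfun1r.
Qed.

Lemma sactM g g' C : sact (g * g')%g C = sact g (sact g' C).
Proof.
rewrite /sact image_comp; apply: eq_imagel => A _ /=.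
by rewrite twist_comp // !twistM // !comp_lfunA.
Qed.

Variable C : set 'End(V).

Record saut :=
  SAut { saut_val :> semitriple bV; _ : `[< sact saut_val C = C >] }.
HB.instance Definition _ := [isSub for saut_val].
HB.instance Definition _ := [Choice of saut by <:].

Lemma saut_closed : group_closed (fun g => `[< sact g C = C >]).
Proof.
split=> [|g g']; first by apply/asboolP; exact: sact1.
move=> /asboolP gC /asboolP g'C; apply/asboolP.
by rewrite sactM -{1}g'C -(sactM _ g') mulVg sact1.
Qed.
HB.instance Definition _ := SubChoice_isSubGroup.Build _ _ saut saut_closed.

Definition saut_proj (g : saut) : gal_of E := st_rho g.

Lemma saut_incl_proof (g : laut C) :
  `[< sact (SemiTriple bV (lpart g) (rpart g) 1%g) C = C >].
Proof.
apply/asboolP; case: g => g /= /asboolP {2}<-; apply: eq_imagel => A _ /=.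
by rewrite twist1.
Qed.

Definition saut_incl (g : laut C) : saut := SAut (saut_incl_proof g).

Fact saut_inclM : {morph saut_incl : g g' / (g * g')%g}.
Proof.
move=> g g'; apply: val_inj; congr SemiTriple => /=.
- by rewrite gl_twist_1.
- by rewrite gl_twist_1.
- by rewrite mulg1.
Qed.
Fact saut_incl1 : saut_incl 1%g = 1%g.
Proof. exact: val_inj. Qed.
HB.instance Definition _ :=
  isUMagmaMorphism.Build _ _ saut_incl (conj saut_incl1 saut_inclM).

End SemilinearGroup.

Arguments saut_proj {F0 L E V n b} bV C g.
Arguments saut_incl {F0 L E V n b} bV C g.

Definition short_exact (G1 G2 G3 : groupType)
    (i : {multiplicative G1 -> G2}) (p : {multiplicative G2 -> G3}) : Prop :=
  [/\ injective i, range i = [set g | p g = 1%g] & range p = setT].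

Section Code.
Variables (F0 : fieldType) (L : splittingFieldType F0).
Variables (Fq K E : {subfield L}) (q n s h c : nat).

Local Notation ell := (gcdn n s).

(* V = L^ell with the scalars of E acting by coordinatewise multiplication *)
Definition codeV : vectType (subvs_of E) := {ffun 'I_ell -> fieldOver E}.

(* the extension of sigma to L *)
Definition sigmaL (x : L) : L := x ^+ (q ^ h).

Definition gammaL (x : L) : L := x ^+ (q ^ (h * c * s)).

(* alpha . (x_0, .., x_(ell-1)) = (alpha x_0, .., alpha^(sigma^(ell-1)) x_(ell-1)) *)
Definition Kscale (alpha : subvs_of K) (x : codeV) : codeV :=
  [ffun i : 'I_ell => (iter i sigmaL (vsval alpha) * x i : L)].

(* T_(w,sigma) (x_0, .., x_(ell-1)) = (x_1, .., x_(ell-1), w gamma(x_0));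
   [ordS] is the cyclic successor, so [ordS i] is 0 when i = ell - 1. *)
Definition Tmap (w : L) (x : codeV) : codeV :=
  [ffun i : 'I_ell =>
     (if i.+1 == ell then w * gammaL (x (ordS i)) else x (ordS i) : L)].

Definition code (k : nat) (w : L) : set 'End(codeV) :=
  [set A | exists alpha : 'I_(s * k) -> subvs_of K,
     forall x, A x = \sum_(i < s * k) Kscale (alpha i) (iter i (Tmap w) x)].

Definition Hplus (u : L) : set (gal_of E) :=
  [set rho | exists lam : L,
     [/\ lam \in Fq, lam != 0 & rho u = lam * u]].

Definition Hminus (u : L) : set (gal_of E) :=
  [set rho | exists lam : L,
     [/\ lam \in Fq, lam != 0 & rho u = lam * u^-1]].

Definition HF (u : L) : set (gal_of E) :=
  if n == 2 then Hplus u `|` Hminus u else Hplus u.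

End Code.

Arguments code {F0 L} K E q n s h c k w.
Arguments HF {F0 L} Fq E n u.

(* Main.v *)
(* The ring generated by K and T is R = K[T; sigma] / (F(T^n)), and the code C is
   the set of classes of skew polynomials of degree < sk < sn.

   Suppose M C^rho N = C and absorb rho into M and N, which become semilinear
   over E. Both idealizers of C are K (compare leading terms), so conjugation by
   M preserves K, and theta = M T M^-1 again satisfies theta a = sigma(a) theta.
   Moreover MN is an invertible element of C commuting with K up to a power of
   sigma, hence C is the K-span of the elements theta^i M N, i < sk, which are
   homogeneous for the grading by Z/n. All of them but the last are mapped into C
   by theta, so theta T^i lies in C for all i < sk outside one residue class
   modulo n. Comparing degrees forces theta = b T, or n = 2 and theta = b T^-1,
   with b in K. Taking n-th powers, rho(u) = theta^n is N_(K/F_q)(b) u^(+-1).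

   Conversely, let rho(u) = lambda z^n u with lambda in F_q^* and z in E: take
   z = 1 for H_F^+, and z = u^-1 with n = 2 for H_F^-. Write lambda =
   N_(K/F_q)(mu). By Hilbert 90 a diagonal matrix composed with the
   coordinatewise extension of rho to L conjugates T into mu z T. This is mu T,
   or mu T^-1 when n = 2 and z = u^-1, as then T^2 = u; in the second case one
   multiplies by T^(s-1) on the right. *)
Require Import Defs.
From HB Require Import structures.
From mathcomp Require Import all_boot all_order all_algebra.
From mathcomp Require Import all_fingroup all_solvable all_field.
From mathcomp Require Import boolp classical_sets.
From mathcomp Require Import zify.

Set Implicit Arguments.
Unset Strict Implicit.
Unset Printing Implicit Defensive.

Import GRing.Theory.
Local Open Scope classical_set_scope.
Local Open Scope ring_scope.

(** * Codes of skew polynomials in an abstract ring *)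

Section SkewEvaluation.
Variables (K : fieldType) (A : pzRingType) (kap : {rmorphism K -> A}) (Q : nat).
Variables (T T1 : A).
Hypothesis TT1 : T * T1 = 1.
Hypothesis T1T : T1 * T = 1.
Hypothesis Tk : forall a, T * kap a = kap (a ^+ Q) * T.

Implicit Types p r g : {poly K}.

(** The polynomial only stores coefficients: products in [{poly K}] are commutative and match those
    of [A] just for scalars on the left and powers of ['X] on the right. *)
Definition skew_eval (p : {poly K}) : A := \sum_(i < size p) kap p`_i * T ^+ i.
Local Notation ev := skew_eval.

Lemma skew_eval_wide p m : (size p <= m)%N -> ev p = \sum_(i < m) kap p`_i * T ^+ i.
Proof.
move=> le_pm; rewrite /ev (big_ord_widen _ (fun i => kap p`_i * T ^+ i) le_pm).
rewrite big_mkcond /=; apply: eq_bigr => i _; case: ltnP => // le_pi.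
by rewrite nth_default // rmorph0 mul0r.
Qed.

Lemma skew_eval_poly m (f : nat -> K) :
  ev (\poly_(i < m) f i) = \sum_(i < m) kap (f i) * T ^+ i.
Proof.
rewrite (skew_eval_wide (size_poly _ _)); apply: eq_bigr => i _.
by rewrite coef_poly ltn_ord.
Qed.

Lemma skew_eval_is_zmod_morphism : zmod_morphism ev.
Proof.
move=> p r; have le_p := leq_maxl (size p) (size r).
have le_r := leq_maxr (size p) (size r).
have le_pr : (size (p - r)%R <= maxn (size p) (size r))%N.
  by rewrite (leq_trans (size_polyD _ _)) // size_polyN.
rewrite (skew_eval_wide le_p) (skew_eval_wide le_r) (skew_eval_wide le_pr) -sumrB.
by apply: eq_bigr => i _; rewrite coefB rmorphB mulrBl.
Qed.
HB.instance Definition _ :=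
  GRing.isZmodMorphism.Build {poly K} A ev skew_eval_is_zmod_morphism.

Lemma skew_evalZ a p : ev (a *: p) = kap a * ev p.
Proof.
rewrite (skew_eval_wide (size_scale_leq a p)) mulr_sumr.
by apply: eq_bigr => i _; rewrite coefZ rmorphM mulrA.
Qed.

Lemma skew_evalC a : ev a%:P = kap a.
Proof.
by rewrite (skew_eval_wide (size_polyC_leq1 a)) big_ord1 coefC expr0 mulr1.
Qed.

Lemma skew_evalMXn p m : ev (p * 'X^m) = ev p * T ^+ m.
Proof.
have [->|p0] := eqVneq p 0; first by rewrite mul0r raddf0 mul0r.
rewrite /ev size_mulXn // big_split_ord /= big1 ?add0r => [|i _].
  rewrite mulr_suml; apply: eq_bigr => i _.
  by rewrite coefMXn ltnNge leq_addr /= addKn -mulrA -exprD addnC.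
by rewrite coefMXn ltn_ord rmorph0 mul0r.
Qed.

Lemma skew_evalXn m : ev 'X^m = T ^+ m.
Proof. by rewrite -[X in ev X]mul1r skew_evalMXn skew_evalC rmorph1 mul1r. Qed.

Lemma Xn_kap (X : A) m : (forall a, X * kap a = kap (a ^+ Q) * X) ->
  forall a, X ^+ m * kap a = kap (a ^+ (Q ^ m)) * X ^+ m.
Proof.
move=> Xk; elim: m => [|m IHm] a; first by rewrite expr0 mul1r mulr1.
by rewrite exprS -mulrA IHm mulrA Xk -!mulrA -exprM expnSr.
Qed.

Lemma kap_Xn (X : A) b m : (forall a, X * kap a = kap (a ^+ Q) * X) ->
  (kap b * X) ^+ m = kap (\prod_(i < m) b ^+ (Q ^ i)) * X ^+ m.
Proof.
move=> Xk; elim: m => [|m IHm]; first by rewrite big_ord0 rmorph1 mulr1.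
by rewrite exprSr IHm -mulrA (mulrA (X ^+ m)) Xn_kap // big_ord_recr /= rmorphM
  exprSr !mulrA.
Qed.

(** The coefficients after [T ^+ m] has been moved from the left to the right. *)
Definition frob_poly m (p : {poly K}) := \poly_(i < size p) (p`_i ^+ (Q ^ m)).

Lemma size_frob_poly m p : size (frob_poly m p) = size p.
Proof.
have [->|p0] := eqVneq p 0; last first.
  by apply: size_poly_eq; rewrite expf_neq0 // -lead_coefE lead_coef_eq0.
by apply/eqP; rewrite size_poly0 -leqn0 (leq_trans (size_poly _ _)) ?size_poly0.
Qed.

Lemma Tn_skew_eval m p : T ^+ m * ev p = ev (frob_poly m p * 'X^m).
Proof.
rewrite skew_evalMXn skew_eval_poly mulr_sumr mulr_suml; apply: eq_bigr => i _.
by rewrite mulrA Xn_kap // -!mulrA -!exprD addnC.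
Qed.

Lemma skew_eval_kap p a :
  ev p * kap a = ev (\poly_(i < size p) (p`_i * a ^+ (Q ^ i))).
Proof.
rewrite skew_eval_poly mulr_suml; apply: eq_bigr => i _.
by rewrite -mulrA Xn_kap // mulrA rmorphM.
Qed.

Lemma TnK m X : X * T ^+ m * T1 ^+ m = X.
Proof.
elim: m X => [|m IHm] X; first by rewrite !mulr1.
by rewrite exprSr exprS -!mulrA (mulrA T) TT1 mul1r mulrA IHm.
Qed.

Variable m0 : nat.
Hypothesis indep : forall p, (size p <= m0)%N -> ev p = 0 -> p = 0.
Hypothesis m0_gt0 : (0 < m0)%N.

Lemma skew_eval_inj p r :
  (size p <= m0)%N -> (size r <= m0)%N -> ev p = ev r -> p = r.
Proof.
move=> lep ler epr; apply/eqP; rewrite -subr_eq0; apply/eqP/indep.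
  by rewrite (leq_trans (size_polyD _ _)) // size_polyN geq_max lep.
by rewrite raddfB /= epr subrr.
Qed.

Lemma kap_inj : injective kap.
Proof.
move=> a b eab; apply/polyC_inj/skew_eval_inj; rewrite ?skew_evalC //.
- exact: leq_trans (size_polyC_leq1 _) _.
- exact: leq_trans (size_polyC_leq1 _) _.
Qed.

Lemma skew_oner_neq0 : (1 : A) <> 0.
Proof.
move=> e; have/eqP := oner_neq0 K; apply.
by apply: kap_inj; rewrite rmorph1 rmorph0.
Qed.

(** * The code of degree below [t] and its idealizers *)

Variable t : nat.
Hypothesis t_gt0 : (0 < t)%N.
Hypothesis t_lt : (t < m0)%N.

Definition in_code (X : A) := exists2 p : {poly K}, (size p <= t)%N & X = ev p.

Lemma in_code_kapl a X : in_code X -> in_code (kap a * X).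
Proof.
move=> [p lep ->]; exists (a *: p); last by rewrite skew_evalZ.
exact: leq_trans (size_scale_leq _ _) _.
Qed.

Lemma in_code_kapr a X : in_code X -> in_code (X * kap a).
Proof.
move=> [p lep ->]; rewrite skew_eval_kap; eexists; last by [].
exact: leq_trans (size_poly _ _) _.
Qed.

Lemma in_codeTn i : (i < t)%N -> in_code (T ^+ i).
Proof. by move=> lti; exists 'X^i; rewrite ?size_polyXn ?skew_evalXn. Qed.

Lemma in_code_size p : (size p <= m0)%N -> in_code (ev p) -> (size p <= t)%N.
Proof.
move=> lep [r ler e]; rewrite (skew_eval_inj lep _ e) //.
exact: leq_trans ler (ltnW t_lt).
Qed.

(** Applied to [1], the hypothesis makes [Y] a skew polynomial. If its degree [d] were positive,
    [Y * T ^+ (t - d)] would have degree exactly [t < m0] and leave the code. *)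
Lemma left_idealizer Y :
  (forall X, in_code X -> in_code (Y * X)) -> exists a, Y = kap a.
Proof.
move=> YC; have [|p lep] := YC 1; first by rewrite -(expr0 T); apply: in_codeTn.
rewrite mulr1 => eY; have [le_p1|lt1p] := leqP (size p) 1%N.
  by exists p`_0; rewrite eY {1}(size1_polyC le_p1) skew_evalC.
have p0 : p != 0 by rewrite -size_poly_gt0; lia.
have lt_t : (t - (size p).-1 < t)%N by lia.
have := YC _ (in_codeTn lt_t); rewrite eY -skew_evalMXn.
by move/in_code_size; rewrite size_mulXn //; lia.
Qed.

Lemma right_idealizer Y :
  (forall X, in_code X -> in_code (X * Y)) -> exists a, Y = kap a.
Proof.
move=> YC; have [|p lep] := YC 1; first by rewrite -(expr0 T); apply: in_codeTn.
rewrite mul1r => eY; have [le_p1|lt1p] := leqP (size p) 1%N.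
  by exists p`_0; rewrite eY {1}(size1_polyC le_p1) skew_evalC.
have p0 m : frob_poly m p != 0 by rewrite -size_poly_gt0 size_frob_poly; lia.
have lt_t : (t - (size p).-1 < t)%N by lia.
have := YC _ (in_codeTn lt_t); rewrite eY Tn_skew_eval.
by move/in_code_size; rewrite size_mulXn // size_frob_poly; lia.
Qed.

Definition stabilizes M N := forall X, in_code X -> in_code (M * X * N).

(** [M1] and [N1] move a codeword back into the code, so [M * kap a * M1] lies in the left
    idealizer. *)
Lemma conj_kap_left M M1 N N1 : stabilizes M N -> stabilizes M1 N1 ->
  N1 * N = 1 -> forall a, exists b, M * kap a * M1 = kap b.
Proof.
move=> sMN sM1N1 eN a; apply: left_idealizer => X XC.
suff -> : M * kap a * M1 * X = M * (kap a * (M1 * X * N1)) * N.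
  by apply/sMN/in_code_kapl/sM1N1.
by rewrite -!mulrA eN mulr1.
Qed.

Lemma conj_kap_right M M1 N N1 : stabilizes M N -> stabilizes M1 N1 ->
  M * M1 = 1 -> forall a, exists b, N1 * kap a * N = kap b.
Proof.
move=> sMN sM1N1 eM a; apply: right_idealizer => X XC.
suff -> : X * (N1 * kap a * N) = M * (M1 * X * N1 * kap a) * N.
  by apply/sMN/in_code_kapr/sM1N1.
by rewrite !mulrA eM mul1r.
Qed.

(** * Homogeneous elements for the grading modulo [n] *)

Variables (n : nat).
Hypothesis Q_order :
  forall i j, (forall a : K, a ^+ (Q ^ i) = a ^+ (Q ^ j)) -> i = j %[mod n].

(** Both sides are moved past [kap a]: the term in [T ^+ i] produces [a ^+ (Q ^ i)], whereas
    [th * T ^+ r] produces [a ^+ (Q ^ r.+1)]. [Q_order] separates the two. *)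
Lemma skew_eval_homog th g (r : nat) :
  (forall a, th * kap a = kap (a ^+ Q) * th) -> (size g <= t)%N ->
  th * T ^+ r = ev g -> forall i, g`_i != 0 -> i = r.+1 %[mod n].
Proof.
move=> thk leg eg i gi; apply: Q_order => a.
have : ev g * kap a = kap (a ^+ (Q ^ r.+1)) * ev g.
  by rewrite -eg -mulrA Xn_kap // !mulrA thk -exprM expnSr.
rewrite skew_eval_kap -skew_evalZ => /skew_eval_inj e.
have/(congr1 (fun p : {poly K} => p`_i)) : _ := e (leq_trans (size_poly _ _)
  (leq_trans leg (ltnW t_lt))) (leq_trans (size_scale_leq _ _)
  (leq_trans leg (ltnW t_lt))).
rewrite coefZ coef_poly; case: ltnP => [_|le]; last first.
  by rewrite nth_default ?eqxx // in gi.
by rewrite mulrC => /(mulIf gi).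
Qed.

(* If [g] had degree at least [r + n], multiplying [th * T ^+ r = ev g] by
   powers of [T ^+ n] would reach a degree in [t, t + n) without reduction
   modulo [m0] before leaving the range in which [th * T ^+ (r + n * j)] is
   known to be a codeword. *)
Lemma size_homog th g (r : nat) e0 :
  (0 < n)%N -> (r < t)%N -> (t <= e0 < m0)%N -> e0 = r.+1 %[mod n] ->
  (forall j, (r + n * j < t)%N -> in_code (th * T ^+ (r + n * j))) ->
  th * T ^+ r = ev g -> (forall i, g`_i != 0 -> i = r.+1 %[mod n]) ->
  (size g <= t)%N -> (size g <= r + n)%N.
Proof.
move=> n0 rt /andP[te0 e0m] e0r thC eg gr leg; rewrite leqNgt; apply/negP=> ltg.
have g0 : g != 0 by rewrite -size_poly_gt0; lia.
pose d := (size g).-1; have sg : size g = d.+1 by rewrite /d; lia.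
have dr : d = r.+1 %[mod n] by apply: gr; rewrite -lead_coefE lead_coef_eq0.
pose e := (t + (e0 - t) %% n)%N.
have ltn_e : ((e0 - t) %% n < n)%N by rewrite ltn_pmod.
have le_e : ((e0 - t) %% n <= e0 - t)%N by rewrite leq_mod.
have ed : e = d %[mod n].
  by rewrite dr -e0r /e modnDmr; congr (_ %% _)%N; lia.
have : (n %| e - d)%N by rewrite -eqn_mod_dvd ?ed //; rewrite /e; lia.
case/dvdnP=> j ej; have eE : e = (d + n * j)%N.
  by rewrite mulnC -ej; rewrite /e; lia.
have rj : (r + n * j < t)%N.
  rewrite /e in eE; lia.
have := thC j rj; rewrite exprD mulrA eg -skew_evalMXn => /in_code_size.
rewrite size_mulXn // sg; rewrite /e in eE; lia.
Qed.

(** * The conjugate of [T] under an equivalence of the code *)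

Section Equivalence.
Variables (M M1 N N1 : A).
Hypotheses (MM1 : M * M1 = 1) (M1M : M1 * M = 1).
Hypotheses (NN1 : N * N1 = 1) (N1N : N1 * N = 1).
Hypotheses (sMN : stabilizes M N) (sM1N1 : stabilizes M1 N1).

Let th := M * T * M1.

(** Conjugation by [M] preserves the image of [kap] and, being multiplicative, commutes with raising
    to the power [Q]. *)
Lemma conj_T_kap a : th * kap a = kap (a ^+ Q) * th.
Proof.
have [b eb] := conj_kap_left sM1N1 sMN NN1 a.
have ea : kap a * M = M * kap b by rewrite -eb !mulrA MM1 mul1r.
have ea2 m : M * kap b ^+ m = kap a ^+ m * M.
  elim: m => [|m IHm]; first by rewrite mulr1 mul1r.
  by rewrite exprS mulrA -ea -mulrA IHm mulrA -exprS.
have e1 : M1 * kap a = kap b * M1 by rewrite -eb -!mulrA MM1 mulr1.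
by rewrite /th -!mulrA e1 (mulrA T) Tk rmorphXn !mulrA ea2 rmorphXn.
Qed.

(** The codeword [M * N] is nonzero and intertwines the two conjugations of [K]; comparing a nonzero
    coefficient, of index [m], shows that they differ by [m] applications of the power [Q]. *)
Lemma exists_twist_degree : exists m, forall a b,
  N1 * kap a * N = kap b -> M * kap a = kap (b ^+ (Q ^ m)) * M.
Proof.
have [|p lep] := sMN (X := 1); first by rewrite -(expr0 T); apply: in_codeTn.
rewrite mulr1 => ep.
have [i pi0] : exists i, p`_i != 0.
  have [p0|p0] := eqVneq p 0; last first.
    by exists (size p).-1; rewrite -lead_coefE lead_coef_eq0.
  case: skew_oner_neq0.
  have: M1 * (M * N) * N1 = 0 by rewrite ep p0 raddf0 mulr0 mul0r.
  by rewrite mulrA M1M mul1r NN1.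
exists i => a b eb.
have [c ec] := conj_kap_left sMN sM1N1 N1N a.
have eN : N * kap b = kap a * N by rewrite -eb !mulrA NN1 mul1r.
have eM : M * kap a = kap c * M by rewrite -ec -!mulrA M1M mulr1.
suff ecb : c = b ^+ (Q ^ i) by rewrite -ecb.
have : ev p * kap b = kap c * ev p by rewrite -ep -mulrA eN !mulrA eM.
have lep' := leq_trans lep (ltnW t_lt).
rewrite skew_eval_kap -skew_evalZ => /skew_eval_inj e.
have/(congr1 (fun p : {poly K} => p`_i)) :=
  e (leq_trans (size_poly _ _) lep') (leq_trans (size_scale_leq _ _) lep').
rewrite coefZ coef_poly; case: ltnP => [_|le]; last first.
  by rewrite nth_default ?eqxx // in pi0.
by rewrite mulrC => /(mulIf pi0).
Qed.

Lemma conj_T_in_code p : (size p < t)%N -> in_code (th * (M * ev p * N)).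
Proof.
move=> ltp; have -> : th * (M * ev p * N) = M * (T ^+ 1 * ev p) * N.
  by rewrite /th expr1 -!mulrA (mulrA M1) M1M mul1r.
apply: sMN; rewrite Tn_skew_eval; eexists; last by [].
have [->|] := eqVneq (frob_poly 1 p) 0; first by rewrite mul0r size_poly0.
by move=> p0; rewrite size_mulXn // size_frob_poly.
Qed.

(** The codeword [M1 * T ^+ i * N1] is homogeneous of class [i - m] modulo [n], with [m] the twist
    degree. Unless this is the class of [t.-1], its degree is below [t.-1], and multiplication by
    [T] keeps it in the code. *)
Lemma conj_T_good : exists i0, forall i, (i < t)%N -> i <> i0 %[mod n] ->
  in_code (th * T ^+ i).
Proof.
have [m mP] := exists_twist_degree.
exists (t.-1 + m)%N => i lti nri.
have [p lep ep] := sM1N1 (in_codeTn lti).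
have eT : M * ev p * N = T ^+ i.
  by rewrite -ep -!mulrA N1N mulr1 mulrA MM1 mul1r.
rewrite -eT; apply: conj_T_in_code.
rewrite ltn_neqAle lep andbT; apply/eqP => szp; apply: nri.
apply: Q_order => a.
have pt : p`_t.-1 != 0.
  by rewrite -szp -lead_coefE lead_coef_eq0 -size_poly_gt0 szp.
have [b eb] := conj_kap_right sMN sM1N1 MM1 a.
have eN : N1 * kap a = kap b * N1 by rewrite -eb -!mulrA NN1 mulr1.
have eM := mP _ _ eb.
have [c ec] := conj_kap_left sM1N1 sMN NN1 (b ^+ (Q ^ i)).
have eM1 : M1 * kap (b ^+ (Q ^ i)) = kap c * M1.
  by rewrite -ec -!mulrA MM1 mulr1.
have e1 : ev p * kap a = kap c * ev p.
  by rewrite -ep -mulrA eN !mulrA -(mulrA M1) Xn_kap // !mulrA eM1.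
have ecj : c = a ^+ (Q ^ t.-1).
  have lep' := leq_trans lep (ltnW t_lt).
  move: e1; rewrite skew_eval_kap -skew_evalZ => /skew_eval_inj e.
  have/(congr1 (fun p : {poly K} => p`_t.-1)) :=
    e (leq_trans (size_poly _ _) lep') (leq_trans (size_scale_leq _ _) lep').
  rewrite coefZ coef_poly szp prednK // leqnn.
  by rewrite mulrC => /(mulIf pt).
have conjX x y l : M1 * kap x * M = kap y -> M1 * kap (x ^+ l) * M = kap (y ^+ l).
  move=> exy; elim: l => [|l IHl]; first by rewrite !expr0 !rmorph1 mulr1.
  rewrite exprS rmorphM exprS rmorphM -exy -IHl !mulrA.
  by rewrite -(mulrA _ M) MM1 mulr1.
have ec2 := conjX _ _ (Q ^ m)%N ec.
have ea : M1 * kap (b ^+ (Q ^ m)) * M = kap a.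
  by rewrite -mulrA -eM mulrA M1M mul1r.
have ea2 := conjX _ _ (Q ^ i)%N ea.
(* Conjugating [b ^+ (Q ^ (i + m))], read as a power of [b ^+ (Q ^ i)] or of [b ^+ (Q ^ m)], gives
   [a ^+ (Q ^ (t.-1 + m))] and [a ^+ (Q ^ i)] respectively. *)
apply: kap_inj; rewrite expnD exprM -ecj -ec2 -ea2; congr (_ * kap _ * _).
by rewrite -!exprM mulnC.
Qed.

(** Multiplication by [th] keeps [M * ev p * N] in the code when [p] has degree below [t.-1]. This
    condition has codimension one over [K], so some nontrivial combination of any two codewords
    meets it. *)
Lemma conj_T_combination Y Y' : in_code Y -> in_code Y' ->
  exists a b, (a != 0) || (b != 0) /\ in_code (th * (kap a * Y + kap b * Y')).
Proof.
move=> /sM1N1[p lep ep] /sM1N1[p' lep' ep'].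
have eY X : M * (M1 * X * N1) * N = X.
  by rewrite -!mulrA N1N mulr1 mulrA MM1 mul1r.
have [p0|p0] := eqVneq p`_t.-1 0.
  exists 1, 0; split; first by rewrite oner_eq0.
  rewrite rmorph1 rmorph0 mul1r mul0r addr0 -[Y]eY ep.
  apply: conj_T_in_code; rewrite ltn_neqAle lep andbT; apply: contraTneq t_gt0.
  move=> szp; rewrite -szp size_poly_gt0 negbK; move/eqP: p0.
  by rewrite -szp -lead_coefE lead_coef_eq0.
have kM y : exists2 a, M * kap y = kap a * M & y != 0 -> a != 0.
  have [a ea] := conj_kap_left sMN sM1N1 N1N y; exists a.
    by rewrite -ea -!mulrA M1M mulr1.
  apply: contra_neq => a0; apply: kap_inj.
  have : M1 * (M * kap y * M1) * M = kap y.
    by rewrite -!mulrA M1M mulr1 mulrA M1M mul1r.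
  by rewrite ea a0 rmorph0 mulr0 mul0r => <-.
(* Cross-multiplication by the top coefficients cancels the terms of degree [t.-1]; [kM] carries
   these scalars across [M]. *)
have [a ea _] := kM p'`_t.-1; have [b eb b0] := kM (- p`_t.-1).
exists a, b; split; first by rewrite b0 ?orbT // oppr_eq0.
have -> : kap a * Y + kap b * Y' =
    M * ev (p'`_t.-1 *: p + (- p`_t.-1) *: p') * N.
  rewrite raddfD /= !skew_evalZ -ep -ep' mulrDr !mulrA ea eb.
  rewrite mulrDl -!mulrA N1N !mulr1 !(mulrA M) MM1 !mul1r //.
apply: conj_T_in_code.
suff : (size (p'`_t.-1 *: p + (- p`_t.-1) *: p')%R <= t.-1)%N by lia.
apply/leq_sizeP => j; rewrite leq_eqVlt => /orP[/eqP <-|ltj].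
  by rewrite coefD !coefZ mulrC mulNr subrr.
have lej : (t <= j)%N by lia.
by rewrite coefD !coefZ (nth_default 0 (leq_trans lep lej))
  (nth_default 0 (leq_trans lep' lej)) !mulr0 addr0.
Qed.

Variable s : nat.
Hypotheses (n_ge2 : (2 <= n)%N) (s_ge2 : (2 <= s)%N) (t_ge2 : (2 <= t)%N).
Hypotheses (m0E : m0 = (s * n)%N) (ts_le : (t + s <= s * n)%N).

Variable i0 : nat.
Hypothesis i0_good : forall i, (i < t)%N -> i <> i0 %[mod n] -> in_code (th * T ^+ i).

Lemma conj_T_size (r e0 : nat) : (r < t)%N -> r <> i0 %[mod n] ->
  (t <= e0 < m0)%N -> e0 = r.+1 %[mod n] ->
  exists g, [/\ th * T ^+ r = ev g, (size g <= r + n)%N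
             & forall i, g`_i != 0 -> i = r.+1 %[mod n]].
Proof.
move=> rt ri te er; have [g leg eg] := i0_good rt ri.
have gr := skew_eval_homog conj_T_kap leg eg.
exists g; split=> //; apply: size_homog te er _ eg gr leg => //; first by lia.
by move=> j ltj; apply: i0_good => //; rewrite [(r + _)%N]addnC mulnC modnMDl.
Qed.

(** The exponents of [th * T ^+ r] are congruent to [r.+1] modulo [n] and less than [r + n]; as
    [r.+1 < n], only [r.+1] is left. The bound on [t] says that the largest exponent below [s * n]
    in this class is at least [t]. *)
Lemma conj_T_good_residue (r : nat) : (r.+1 < n)%N -> (r < t)%N -> r <> i0 %[mod n] ->
  (t <= r.+1 + n * s.-1)%N -> exists b, th = kap b * T.
Proof.
move=> rn rt ri te.
have [||g [eg leg gr]] := @conj_T_size r (r.+1 + n * s.-1) rt ri.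
- by rewrite te m0E; case: (s) s_ge2 => // s' _; rewrite /= mulSn mulnC; lia.
- by rewrite addnC mulnC modnMDl.
exists g`_r.+1; rewrite -[th](TnK r) eg -[RHS](TnK r); congr (_ * _).
rewrite -mulrA -exprS -skew_evalXn -skew_evalZ; congr (ev _).
apply/polyP => i; rewrite coefZ coefXn; case: eqP => [->|ni]; first by rewrite mulr1.
rewrite mulr0; apply/eqP/negPn/negP => gi.
have lti : (i < r + n)%N.
  by rewrite ltnNge; apply: contraNN gi => lei; rewrite nth_default // (leq_trans leg).
have := gr i gi; rewrite [RHS]modn_small // => e.
have := divn_eq i n; rewrite e; case: (i %/ n)%N => [|d]; first by lia.
by rewrite mulSn; lia.
Qed.

(** Only odd powers of [T] are known to be good here. The power [1] gives [th = x T^-1 + y T], and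
    [x] or [y] must be shown to vanish. For even [t], [th * T ^+ t.-1] is a codeword whose
    coefficient in degree [t] is [y]. For odd [t], a combination of [1] and [T ^+ t.-1] replaces
    it. *)
Lemma conj_T_even : n = 2%N -> 0 = i0 %[mod n] ->
  (exists b, th = kap b * T) \/ (exists b, th = kap b * T1).
Proof.
move=> n2 i00.
have m0E2 : m0 = s.*2 by rewrite m0E n2 muln2.
have ts2 : (t + s <= s * 2)%N by move: ts_le; rewrite n2.
have [||||g [eg leg gr]] := @conj_T_size 1 (s.-1).*2 => //.
- by rewrite -i00 n2.
- by rewrite m0E2; lia.
- by rewrite n2 !modn2 odd_double.
have {}eg : th * T = ev ((g`_0)%:P + g`_2 *: 'X^2).
  rewrite -{1}[T]expr1 eg; congr (ev _); apply/polyP => i.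
  rewrite coefD coefC coefZ coefXn; case: i => [|[|[|i]]] /=.
  - by rewrite mulr0 addr0.
  - rewrite mulr0 addr0; apply/eqP/negPn/negP => /gr.
    by rewrite n2.
  - by rewrite mulr1 add0r.
  - by rewrite mulr0 addr0 nth_default // (leq_trans leg) // n2; lia.
set x := g`_0 in eg; set y := g`_2 in eg; move: x y eg => x y eg.
have thE m : th * T ^+ m.+1 = ev (x *: 'X^m + y *: 'X^(m.+2)).
  rewrite exprS mulrA eg -skew_evalMXn mulrDl -scalerAl -exprD mul_polyC.
  by [].
have thTT1 : th * T * T1 = th by rewrite -mulrA TT1 mulr1.
have thy : y = 0 -> exists b, th = kap b * T1.
  by move=> y0; exists x; rewrite -[LHS]thTT1 eg y0 scale0r addr0 skew_evalC.
have thx : x = 0 -> exists b, th = kap b * T.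
  move=> x0; exists y; rewrite -[LHS]thTT1 eg x0 add0r skew_evalZ skew_evalXn.
  by rewrite -!mulrA TT1 mulr1.
have sz (p : {poly K}) m j : (size p <= m)%N -> (m <= j)%N -> p`_j = 0.
  by move=> lep lem; rewrite nth_default // (leq_trans lep).
have ts : (t <= s)%N by lia.
have [todd|teven] := boolP (odd t); last first.
  right; apply: thy.
  have : in_code (th * T ^+ t.-2.+1).
    apply: i0_good; first by lia.
    by rewrite -i00 n2 !modn2; move: teven; lia.
  rewrite thE => /in_code_size h.
  have {h} : (size (x *: 'X^(t.-2) + y *: 'X^(t.-2.+2))%R <= t)%N.
    apply: h; rewrite (leq_trans (size_polyD _ _)) // geq_max.
    rewrite !(leq_trans (size_scale_leq _ _)) // size_polyXn; lia.
  move/sz => /(_ t (leqnn _)); rewrite coefD !coefZ !coefXn.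
  have -> : t.-2.+2 = t by lia.
  by rewrite eqxx mulr1 (_ : (t == t.-2) = false) ?mulr0 ?add0r //; lia.
have in1 : in_code 1 by rewrite -(expr0 T); apply: in_codeTn.
have inT : in_code (T ^+ t.-1) by apply: in_codeTn; lia.
have [a [b [ab [h leh eh]]]] := conj_T_combination in1 inT.
(* The image of the combination, multiplied by [T] on the right to clear [T^-1]. Its extreme
   coefficients [a ^+ Q * x] and [b ^+ Q * y], in degrees [0] and [t.+1], vanish because [p] equals
   [h * 'X] with [size h <= t]. *)
pose p := a ^+ Q *: (x *: 'X^0 + y *: 'X^2)
          + b ^+ Q *: (x *: 'X^(t.-1) + y *: 'X^(t.-1.+2)).
have eh2 : h * 'X^1 = p.
  apply: skew_eval_inj.
  - have [->|h0] := eqVneq h 0; first by rewrite mul0r size_poly0.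
    by rewrite size_mulXn //; lia.
  - have le1 (c d : K) i j : (i.+1 <= m0)%N -> (j.+1 <= m0)%N ->
        (size (c *: 'X^i + d *: 'X^j)%R <= m0)%N.
      move=> li lj; rewrite (leq_trans (size_polyD _ _)) // geq_max.
      by rewrite !(leq_trans (size_scale_leq _ _)) // size_polyXn.
    rewrite (leq_trans (size_polyD _ _)) // geq_max.
    by rewrite !(leq_trans (size_scale_leq _ _)) // le1 //; lia.
  rewrite skew_evalMXn -eh raddfD /= !skew_evalZ -!thE mulr1 mulrDr mulrDl.
  rewrite !expr1 !(mulrA th) !conj_T_kap -!mulrA; congr (_ + _ * (_ * _)).
  by rewrite -exprSr.
have t3 : (3 <= t)%N by lia.
have c0 : a ^+ Q * x = 0.
  have := congr1 (fun q : {poly K} => q`_0) eh2.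
  rewrite coefMXn /= coefD !coefZ !coefD !coefZ !coefXn /=.
  have -> : (0 == t.-1)%N = false by lia.
  by rewrite !mulr0 !addr0 mulr0 addr0 mulr1 => <-.
have ct : b ^+ Q * y = 0.
  have := congr1 (fun q : {poly K} => q`_t.+1) eh2.
  rewrite coefMXn /= coefD !coefZ !coefD !coefZ !coefXn /=.
  rewrite subn1 /= (sz _ _ _ leh) // (_ : t.-1.+2 = t.+1); last by lia.
  rewrite eqxx (_ : (t.+1 == 2)%N = false); last by lia.
  rewrite (_ : (t.+1 == t.-1)%N = false); last by lia.
  by rewrite !mulr0 !addr0 mulr0 !add0r mulr1.
have [a0|a0] := eqVneq a 0.
  right; apply: thy; move: ct => /eqP; rewrite mulf_eq0 expf_eq0.
  by move: ab; rewrite a0 eqxx /= => /negPf ->; rewrite andbF => /eqP.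
left; apply: thx; move: c0 => /eqP; rewrite mulf_eq0 expf_eq0.
by rewrite (negPf a0) andbF => /eqP.
Qed.

(** At most one residue class is bad, so one of two consecutive exponents is good: [0] and [1] if
    [t <= n.-2], otherwise [n.-2] and [n - 3], for which [t + s <= s * n] and [2 <= s] give the
    required bound on [t]. For [n = 2] only [0] satisfies [r.+1 < n], whence the separate even
    case. *)
Lemma conj_T_monomial :
  (exists b, th = kap b * T) \/ (n = 2%N /\ exists b, th = kap b * T1).
Proof.
have [n2|n3] : n = 2%N \/ (3 <= n)%N by lia.
  have [i00|i00] := eqVneq (0 %% n)%N (i0 %% n)%N.
    by have [|] := conj_T_even n2 i00; [left | right].
  have ts2 : (t + s <= s * 2)%N by move: ts_le; rewrite n2.
  left; apply: (@conj_T_good_residue 0); [lia | lia | exact/eqP | by rewrite n2; lia].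
left; have le_n : (n <= n * s.-1)%N by rewrite leq_pmulr; lia.
have nss : (n * s.-1 + n = s * n)%N.
  by case: (s) s_ge2 => // s' _; rewrite /= mulSn mulnC addnC.
have [tn|tn] := leqP t n.-2.
  have [i00|i00] := eqVneq (0 %% n)%N (i0 %% n)%N.
    apply: (@conj_T_good_residue 1) => //; try lia.
    by rewrite -i00 mod0n modn_small //; lia.
  by apply: (@conj_T_good_residue 0) => //; try lia; apply/eqP.
have [in2|in2] := eqVneq (n.-2 %% n)%N (i0 %% n)%N; last first.
  by apply: (@conj_T_good_residue n.-2) => //; try lia; apply/eqP.
apply: (@conj_T_good_residue (n - 3)) => //; try lia.
by rewrite -in2 !modn_small; lia.
Qed.

End Equivalence.

Lemma skew_equivalence M M1 N N1 s : M * M1 = 1 -> M1 * M = 1 ->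
  N * N1 = 1 -> N1 * N = 1 -> stabilizes M N -> stabilizes M1 N1 ->
  (2 <= n)%N -> (2 <= s)%N -> (2 <= t)%N -> m0 = (s * n)%N -> (t + s <= s * n)%N ->
  (exists b, M * T * M1 = kap b * T) \/
  (n = 2%N /\ exists b, M * T * M1 = kap b * T1).
Proof.
move=> eM eM1 eN eN1 sMN sMN1 n2 s2 t2 m0E ts.
have [i0 good] := conj_T_good eM eM1 eN eN1 sMN sMN1.
by eapply (@conj_T_monomial M M1 N N1 eM eM1 eN eN1 sMN sMN1 s); eassumption.
Qed.

(** * Equivalences built from conjugations of [T] *)

Lemma conj_Xn (M X : A) mu i : (forall a, X * kap a = kap (a ^+ Q) * X) ->
  M * T = kap mu * X * M ->
  M * T ^+ i = kap (\prod_(l < i) mu ^+ (Q ^ l)) * X ^+ i * M.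
Proof.
move=> Xk MT; rewrite -kap_Xn //; elim: i => [|i IHi]; first by rewrite mulr1 mul1r.
by rewrite exprS mulrA MT -mulrA IHi mulrA -exprS.
Qed.

Lemma stabilizes_conj M M1 (rho : K -> K) mu : M * M1 = 1 ->
  (forall a, M * kap a = kap (rho a) * M) -> M * T = kap mu * T * M ->
  stabilizes M M1.
Proof.
move=> MM1 Mk MT _ [p lep ->].
exists (\poly_(i < t) (rho p`_i * \prod_(l < i) mu ^+ (Q ^ l))).
  exact: size_poly.
rewrite skew_eval_poly (skew_eval_wide lep) mulr_sumr mulr_suml.
apply: eq_bigr => i _.
by rewrite !mulrA Mk -!mulrA (mulrA M) (conj_Xn i Tk MT) rmorphM -!mulrA MM1 mulr1.
Qed.

(* Conjugating [T] to a multiple of [T1] reverses the order of the powers of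
   [T]; the factor [T ^+ t.-1] shifts them back. *)
Lemma stabilizes_conj_inv M M1 (rho : K -> K) mu : M * M1 = 1 ->
  (forall a, M * kap a = kap (rho a) * M) -> M * T = kap mu * T1 * M ->
  (forall a, T1 * kap a = kap (a ^+ Q) * T1) ->
  stabilizes M (M1 * T ^+ t.-1).
Proof.
move=> MM1 Mk MT T1k _ [p lep ->].
have T1n i : (i < t)%N -> T1 ^+ i * T ^+ t.-1 = T ^+ (t.-1 - i).
  move=> lti; rewrite -{1}(subnKC (_ : i <= t.-1)%N); last by lia.
  rewrite exprD mulrA; suff -> : T1 ^+ i * T ^+ i = 1 by rewrite mul1r.
  elim: i {lti} => [|i IHi]; first by rewrite mulr1.
  by rewrite exprSr exprS -mulrA (mulrA T1) T1T mul1r.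
pose c i := rho p`_i * \prod_(l < i) mu ^+ (Q ^ l).
exists (\poly_(i < t) c (t.-1 - i)%N); first exact: size_poly.
rewrite skew_eval_poly (reindex_inj rev_ord_inj) /= (skew_eval_wide lep).
rewrite mulr_sumr mulr_suml; apply: eq_bigr => i _.
have -> : (t - i.+1 = t.-1 - i)%N by lia.
have -> : (t.-1 - (t.-1 - i) = i)%N by have := ltn_ord i; lia.
rewrite !mulrA Mk -!mulrA (mulrA M) (conj_Xn i T1k MT) rmorphM -!mulrA (mulrA M).
by rewrite MM1 mul1r T1n.
Qed.

(** Handles the inverse of the pair [(M, M1 * T ^+ t.-1)]. [T1 ^+ t.-1 * M] is [M * T ^+ t.-1] up to
    the scalar [nu], which the code absorbs on its right, so [stabilizes_conj_inv] applies with [M]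
    and [M1] exchanged. *)
Lemma stabilizes_conj_inv' M M1 (rho : K -> K) mu : M1 * M = 1 -> mu != 0 ->
  (forall a, M1 * kap a = kap (rho a) * M1) -> M * T = kap mu * T1 * M ->
  M1 * T = kap (rho mu ^+ Q) * T1 * M1 ->
  (forall a, T1 * kap a = kap (a ^+ Q) * T1) ->
  stabilizes M1 (T1 ^+ t.-1 * M).
Proof.
move=> M1M mu0 M1k MT M1T T1k X XC.
set nu := \prod_(l < t.-1) mu ^+ (Q ^ l).
have nu0 : nu != 0 by apply/prodf_neq0 => l _; rewrite expf_neq0.
have eT : kap nu^-1 * (M * T ^+ t.-1) = T1 ^+ t.-1 * M.
  by rewrite (conj_Xn t.-1 T1k MT) !mulrA -rmorphM mulVf // rmorph1 mul1r.
rewrite -eT !mulrA -(mulrA M1) -mulrA.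
exact: (stabilizes_conj_inv M1M M1k M1T T1k (in_code_kapr nu^-1 XC)).
Qed.

End SkewEvaluation.

(** * Finite fields *)

Lemma big_cycle (R : Type) (idx : R) (op : Monoid.com_law idx)
    (gT : finGroupType) (x : gT) (F : gT -> R) :
  \big[op/idx]_(g in <[x]>%g) F g = \big[op/idx]_(i < #[x]%g) F (x ^+ i)%g.
Proof.
have inj : {in [pred i : 'I_(#[x]%g) | true] &,
    injective (fun i : 'I_(#[x]%g) => x ^+ i)%g}.
  move=> i j _ _ /eqP; rewrite eq_expg_mod_order !modn_small // => /eqP.
  exact: val_inj.
rewrite -(big_imset _ inj); apply: eq_bigl => g; apply/idP/imsetP.
  by move=> /cyclePmin[i lti ->]; exists (Ordinal lti).
by move=> [i _ ->]; exact: mem_cycle.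
Qed.

Section FiniteFields.
Variables (p : nat) (p_prime : prime p) (L : splittingFieldType 'F_p).

Lemma mem_subfieldE (E : {subfield L}) (a : L) :
  (a \in E) = (a ^+ (p ^ \dim E) == a).
Proof. by rewrite Fermat's_little_theorem card_Fp. Qed.

Lemma exp_in_subfield (E : {subfield L}) (a : L) m :
  a \in E -> a ^+ (p ^ (\dim E * m)) = a.
Proof.
rewrite mem_subfieldE => /eqP aE; elim: m => [|m IHm]; first by rewrite muln0 expr1.
by rewrite mulnS expnD exprM aE.
Qed.

Lemma subfield_dvd (E E' : {subfield L}) m :
  \dim E' = (\dim E * m)%N -> (E <= E')%VS.
Proof.
move=> dimE; apply/subvP => a aE; rewrite mem_subfieldE dimE.
by rewrite exp_in_subfield.
Qed.

Lemma frobD m (x y : L) : (x + y) ^+ (p ^ m) = x ^+ (p ^ m) + y ^+ (p ^ m).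
Proof.
apply: exprDn_pchar; apply/pnatP; first by rewrite expn_gt0 prime_gt0.
move=> r r_pr; rewrite Euclid_dvdX // dvdn_prime2 // => /andP[/eqP -> _].
by rewrite (pchar_lalg L) pchar_Fp.
Qed.

Lemma gal_of_frob (E : {subfield L}) (rho : gal_of E) :
  exists m, {in E, forall x : L, rho x = x ^+ (p ^ m)}.
Proof.
have [al gen_al alE] := finField_galois_generator (sub1v E).
rewrite card_Fp // dimv1 expn1 in alE.
have : rho \in 'Gal(E / 1)%g by rewrite gal_kHom ?sub1v // k1AHom.
rewrite (eqP gen_al) => /cycleP[m ->]; exists m.
elim: m => [|m IHm] x xE; first by rewrite gal_id expr1.
rewrite expgSr galM // IHm // alE -?exprM -?expnSr //.
by rewrite rpredX.
Qed.

(** [saut_proj] reverses products, as [gal_of E] composes from left to right; commutativity makes it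
    a morphism. *)
Lemma gal_of_commute (E : {subfield L}) (rho rho' : gal_of E) :
  (rho * rho' = rho' * rho)%g.
Proof.
have [m rhoE] := gal_of_frob rho; have [m' rho'E] := gal_of_frob rho'.
apply/eqP/gal_eqP => x xE; rewrite !galM // rhoE // !rho'E ?rhoE ?rpredX //.
by rewrite -!exprM mulnC.
Qed.

(** * Norm, trace and Dedekind independence for a cyclic extension *)

Section Cyclic.
Variables (k0 E : {subfield L}) (sigma : gal_of E) (n Q : nat).
Hypotheses (k0E : (k0 <= E)%VS) (sigma_gen : generator 'Gal(E / k0)%g sigma).
Hypothesis dimE : \dim_k0 E = n.
Hypothesis sigmaE : {in E, forall x : L, sigma x = x ^+ Q}.

Lemma order_sigma : #[sigma]%g = n.
Proof.
rewrite /order -(eqP sigma_gen) -galois_dim ?dimE //.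
exact: finField_galois.
Qed.

Lemma sigmaXE i : {in E, forall x : L, (sigma ^+ i)%g x = x ^+ (Q ^ i)}.
Proof.
elim: i => [|i IHi] x xE; first by rewrite gal_id expr1.
by rewrite expgSr galM // IHi // sigmaE ?rpredX // -exprM -expnSr.
Qed.

Lemma sigma_mod i j : {in E, forall x : L, x ^+ (Q ^ i) = x ^+ (Q ^ j)} <->
  i = j %[mod n].
Proof.
rewrite -order_sigma; split=> [e|/eqP].
  apply/eqP; rewrite -eq_expg_mod_order; apply/gal_eqP => x xE.
  by rewrite !sigmaXE ?e.
by rewrite -eq_expg_mod_order => /eqP e x xE; rewrite -!sigmaXE ?e.
Qed.

Lemma galNorm_sigma : {in E, forall x : L,
  galNorm k0 E x = \prod_(i < n) x ^+ (Q ^ i)}.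
Proof.
move=> x xE; rewrite /galNorm (eqP sigma_gen) big_cycle order_sigma.
by apply: eq_bigr => i _; rewrite sigmaXE.
Qed.

Lemma galTrace_sigma : {in E, forall x : L,
  galTrace k0 E x = \sum_(i < n) x ^+ (Q ^ i)}.
Proof.
move=> x xE; rewrite /galTrace (eqP sigma_gen) big_cycle order_sigma.
by apply: eq_bigr => i _; rewrite sigmaXE.
Qed.

Lemma sigma_independent (f : nat -> L) :
  (forall x : L, x \in E -> \sum_(i < n) f i * x ^+ (Q ^ i) = 0) ->
  forall i, (i < n)%N -> f i = 0.
Proof.
(* Dedekind's lemma takes coefficients indexed by automorphisms: [C g] sums [f i] over the exponents
   [i < n] with [sigma ^+ i = g], of which there is at most one. *)
move=> f0 i lti; pose C (g : gal_of E) := \sum_(i < n | (sigma ^+ i)%g == g) f i.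
have CE j : (j < n)%N -> C (sigma ^+ j)%g = f j.
  move=> ltj; rewrite /C (big_pred1 (Ordinal ltj)) // => l.
  by rewrite eq_expg_mod_order order_sigma !modn_small.
rewrite -(CE _ lti).
apply: (@gal_independent _ _ _ (mem <[sigma]>%g) C) => [x xE|]; last exact: mem_cycle.
rewrite big_cycle order_sigma -[RHS](f0 x xE); apply: eq_bigr => j _.
by rewrite CE // sigmaXE.
Qed.

End Cyclic.

Lemma galNorm_frob (k0 E : {subfield L}) : (k0 <= E)%VS ->
  {in E, forall x : L,
    galNorm k0 E x = x ^+ (\sum_(i < \dim_k0 E) (p ^ \dim k0) ^ i)}.
Proof.
move=> k0E x xE; have [al gen_al alE] := finField_galois_generator k0E.
rewrite card_Fp // in alE.
by rewrite (galNorm_sigma k0E gen_al erefl alE xE) -prodrXr.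
Qed.

(* [N(X) - lam], with [N(X)] the norm as a power of [X], divides
   [X ^ (|E| - 1) - 1], which splits over [E]. *)
Lemma galNorm_surj (k0 E : {subfield L}) (lam : L) : (k0 <= E)%VS ->
  lam \in k0 -> lam != 0 -> exists2 mu, mu \in E & galNorm k0 E mu = lam.
Proof.
move=> k0E lam_k0 lam0.
pose d := \dim_k0 E; pose q := (p ^ \dim k0)%N.
pose m := (\sum_(i < d) q ^ i)%N.
have q_gt0 : (0 < q)%N by rewrite expn_gt0 prime_gt0.
have dE : (\dim k0 * d = \dim E)%N by rewrite mulnC divnK // field_dimS.
have d_gt0 : (0 < d)%N by move: (adim_gt0 E); rewrite -dE muln_gt0 => /andP[].
have m_gt0 : (0 < m)%N.
  by rewrite /m; case: (d) d_gt0 => // d' _; rewrite big_ord_recl.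
have mq : (m * q.-1 = (p ^ \dim E).-1)%N.
  by rewrite -dE expnM -/q predn_exp mulnC.
(* The splitting used is that of [X ^ |L| - X], so the exponent is extended from [|E| - 1] to
   [|L| - 1]; [in_E] brings the root back into [E]. *)
have [c mqc] : exists c, (m * (q.-1 * c) = (p ^ \dim {:L}).-1)%N.
  have /dvdnP[D ->] := field_dimS (subvf E).
  exists (\sum_(i < D) (p ^ \dim E) ^ i)%N.
  by rewrite mulnA mq [(D * _)%N]mulnC expnM (predn_exp (p ^ \dim E)%N).
have lamq : lam ^+ q.-1 = 1.
  apply: (mulfI lam0); rewrite -exprS prednK ?mulr1 //.
  by move: lam_k0; rewrite mem_subfieldE => /eqP.
have in_E mu : mu ^+ m = lam -> mu \in E.
  move=> emu; rewrite mem_subfieldE -[(p ^ _)%N]prednK ?expn_gt0 ?prime_gt0 //.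
  by rewrite exprS -mq exprM emu lamq mulr1.
pose finL := FinFieldExtType L.
have cardL : #|finL| = (p ^ \dim {:L})%N.
  rewrite -[LHS](@card_vspacef 'F_p (finvect_type L) (Vector.class (finvect_type L))).
  by rewrite card_vspace card_Fp.
have dvd : 'X^m - lam%:P %| \prod_(x <- enum finL) ('X - (x : L)%:P).
  have := finField_genPoly finL; rewrite -big_enum /= => <-; rewrite cardL.
  have -> : 'X^(p ^ \dim {:L}) - 'X =
      'X * (('X^m) ^+ (q.-1 * c) - lam%:P ^+ (q.-1 * c)) :> {poly L}.
    rewrite -exprM mqc -rmorphXn exprM lamq expr1n mulrBr mulr1 -exprS prednK //.
    by rewrite expn_gt0 prime_gt0.
  by rewrite dvdp_mull // subrXX dvdp_mulr.
have [msk] := dvdp_prod_XsubC dvd; case def_r: (mask msk _) => [|mu r].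
  rewrite big_nil => /eqp_size; rewrite size_poly1 size_XnsubC //.
  by move=> [e]; rewrite e in m_gt0.
move/eqp_root => /(_ mu); rewrite big_cons rootM root_XsubC eqxx /=.
rewrite rootE !hornerE ?hornerXn subr_eq0 => /eqP emu.
by exists mu; [apply: in_E | rewrite (galNorm_frob k0E) // in_E].
Qed.

(** * Independence of the powers of a root of an irreducible polynomial *)

Section RootOfIrreducible.
Variables (k0 : {subfield L}) (F : {poly subvs_of k0}) (u : L).
Hypothesis F_irr : irreducible_poly F.
Hypothesis Fu : root (map_poly vsval F) u.

(** A relation is a polynomial over [k0] too small to be divisible by [F]; if nonzero, it would be
    coprime to [F] and yet share the root [u]. *)
Lemma root_irreducible_independent s (f : nat -> L) : (s < size F)%N ->
  (forall j, (j < s)%N -> f j \in k0) -> \sum_(j < s) f j * u ^+ j = 0 ->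
  forall j, (j < s)%N -> f j = 0.
Proof.
move=> ltF fk0 f0.
pose G := \poly_(j < s) vsproj k0 (f j).
have Gu : (map_poly vsval G).[u] = 0.
  rewrite -[RHS]f0 (@horner_coef_wide _ s) ?size_map_poly ?size_poly //.
  by apply: eq_bigr => j _; rewrite coef_map coef_poly ltn_ord /= vsprojK ?fk0.
have G0 : G = 0.
  apply/eqP/negPn/negP => G0; have : coprimep F G.
    rewrite irreducible_poly_coprime //; apply: contraTN ltF => /(dvdp_leq G0) le.
    by rewrite -leqNgt (leq_trans le) ?size_poly.
  rewrite -(coprimep_map (vsval : {rmorphism subvs_of k0 -> L})).
  by move/coprimep_root => /(_ _ Fu); rewrite Gu eqxx.
move=> j ltj; have /(congr1 (fun g : {poly _} => vsval g`_j)) := G0.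
by rewrite coef_poly ltj coef0 /= vsprojK ?fk0.
Qed.

End RootOfIrreducible.
End FiniteFields.

(** * The space of the code *)

Section AdditiveEndomorphisms.
Variable V : zmodType.

(** The maps [L_rho], and the equivalences that absorb them, are only semilinear over [E]; the skew
    polynomial argument therefore runs in the ring of additive maps instead of ['End(V)]. *)
Record add_end := AddEnd {
  add_end_fun :> V -> V;
  add_endD : {morph add_end_fun : x y / x + y} }.

HB.instance Definition _ := gen_eqMixin add_end.
HB.instance Definition _ := gen_choiceMixin add_end.

Lemma add_endP (f g : add_end) : f =1 g -> f = g.
Proof.
case: f g => [f fD] [g gD] /= /funext efg; case: g / efg gD => gD.
by congr AddEnd; exact: Prop_irrelevance.
Qed.

Definition add_end_zero := @AddEnd (fun _ => 0) (fun _ _ => esym (addr0 0)).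
Definition add_end_one := @AddEnd id (fun _ _ => erefl).

Fact add_end_opp_proof (f : add_end) : {morph (fun x => - f x) : x y / x + y}.
Proof. by move=> x y; rewrite add_endD opprD. Qed.
Definition add_end_opp f := AddEnd (add_end_opp_proof f).

Fact add_end_add_proof (f g : add_end) :
  {morph (fun x => f x + g x) : x y / x + y}.
Proof. by move=> x y; rewrite !add_endD addrACA. Qed.
Definition add_end_add f g := AddEnd (add_end_add_proof f g).

Fact add_end_mul_proof (f g : add_end) : {morph (fun x => f (g x)) : x y / x + y}.
Proof. by move=> x y; rewrite !add_endD. Qed.
Definition add_end_mul f g := AddEnd (add_end_mul_proof f g).

Fact add_end_addA : associative add_end_add.
Proof. by move=> f g h; apply: add_endP => x /=; rewrite addrA. Qed.
Fact add_end_addC : commutative add_end_add.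
Proof. by move=> f g; apply: add_endP => x /=; rewrite addrC. Qed.
Fact add_end_add0 : left_id add_end_zero add_end_add.
Proof. by move=> f; apply: add_endP => x /=; rewrite add0r. Qed.
Fact add_end_addN : left_inverse add_end_zero add_end_opp add_end_add.
Proof. by move=> f; apply: add_endP => x /=; rewrite addNr. Qed.
HB.instance Definition _ :=
  GRing.isZmodule.Build add_end add_end_addA add_end_addC add_end_add0 add_end_addN.

Fact add_end_mulA : associative add_end_mul.
Proof. by move=> f g h; apply: add_endP. Qed.
Fact add_end_mul1 : left_id add_end_one add_end_mul.
Proof. by move=> f; apply: add_endP. Qed.
Fact add_end_mulr1 : right_id add_end_one add_end_mul.
Proof. by move=> f; apply: add_endP. Qed.
Fact add_end_mulDl : left_distributive add_end_mul +%R.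
Proof. by move=> f g h; apply: add_endP. Qed.
Fact add_end_mulDr : right_distributive add_end_mul +%R.
Proof. by move=> f g h; apply: add_endP => x /=; rewrite add_endD. Qed.
HB.instance Definition _ := GRing.Zmodule_isPzRing.Build add_end
  add_end_mulA add_end_mul1 add_end_mulr1 add_end_mulDl add_end_mulDr.

Lemma add_end_mulE (f g : add_end) x : (f * g) x = f (g x).
Proof. by []. Qed.

Lemma add_end_expE (f : add_end) m x : (f ^+ m) x = iter m f x.
Proof. by elim: m x => [//|m IHm] x; rewrite exprS add_end_mulE IHm. Qed.

Lemma add_end_sumE (I : Type) (r : seq I) (P : pred I) (F : I -> add_end) x :
  (\sum_(i <- r | P i) F i) x = \sum_(i <- r | P i) F i x.
Proof. by apply: (big_morph (fun f : add_end => f x)). Qed.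

End AdditiveEndomorphisms.

(** * Coordinates on [V] and the maps given by [K], [E] and [T] *)

Section CodeSpace.
Variables (p e n s : nat) (p_prime : prime p).
Variables (L : splittingFieldType 'F_p) (K E : {subfield L}) (h c : nat).

Local Notation q := (p ^ e)%N.
Local Notation ell := (gcdn n s).
Local Notation V := (codeV E n s).
Local Notation Q := (q ^ h)%N.

Definition crd (x : V) (i : 'I_ell) : L := x i.
Definition vec (f : 'I_ell -> L) : V := [ffun i => (f i : fieldOver E)].

Lemma crdP (x y : V) : crd x =1 crd y -> x = y.
Proof. by move=> exy; apply/ffunP. Qed.

Lemma crdD x y i : crd (x + y) i = crd x i + crd y i.
Proof. by rewrite {1}/crd ffunE. Qed.

Lemma crd0 i : crd 0 i = 0.
Proof. by rewrite {1}/crd ffunE. Qed.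

Lemma crdZ a x i : crd (a *: x) i = vsval a * crd x i.
Proof. by rewrite {1}/crd ffunE fieldOver_scaleE. Qed.

Lemma crd_vec f i : crd (vec f) i = f i.
Proof. by rewrite /crd ffunE. Qed.

Lemma crd_sum (I : Type) (r : seq I) (P : pred I) (F : I -> V) i :
  crd (\sum_(j <- r | P j) F j) i = \sum_(j <- r | P j) crd (F j) i.
Proof.
apply: (big_morph (fun x => crd x i)); [exact: (fun x y => crdD x y i)|exact: crd0].
Qed.

Lemma iter_sigmaL i (x : L) : iter i (sigmaL q h) x = x ^+ (Q ^ i).
Proof.
by elim: i => [|i IHi]; rewrite ?expr1 //= IHi /sigmaL -exprM -expnSr.
Qed.

Lemma crd_Kscale (a : subvs_of K) x i :
  crd (Kscale q h a x) i = vsval a ^+ (Q ^ i) * crd x i.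
Proof. by rewrite {1}/crd ffunE iter_sigmaL. Qed.

Lemma crd_Tmap w x i : crd (Tmap q h c w x) i =
  if i.+1 == ell then w * gammaL q s h c (crd x (ordS i)) else crd x (ordS i).
Proof. by rewrite {1}/crd ffunE. Qed.

Lemma QXE i : (Q ^ i)%N = (p ^ (e * h * i))%N.
Proof. by rewrite -!expnM mulnA. Qed.

Lemma gammaLE (x : L) : gammaL q s h c x = x ^+ (p ^ (e * (h * c * s))).
Proof. by rewrite /gammaL -expnM. Qed.

Lemma gammaM (x y : L) :
  gammaL q s h c (x * y) = gammaL q s h c x * gammaL q s h c y.
Proof. exact: exprMn. Qed.

(* [p_prime] is made a parameter of [kapA] so that its ring morphism structure,
   whose additivity is the freshman's dream, can be inferred. *)
Fact Kscale_additive (a : subvs_of K) : {morph Kscale q h a : x y / x + y :> V}.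
Proof using p_prime.
by move=> x y; apply: crdP => i; rewrite !(crd_Kscale, crdD) mulrDr.
Qed.
Definition kapA (a : subvs_of K) : add_end V := AddEnd (Kscale_additive a).

Fact Tmap_additive w : {morph Tmap q h c w : x y / x + y :> V}.
Proof.
move=> x y; apply: crdP => i; rewrite !(crd_Tmap, crdD).
by case: eqP => // _; rewrite !gammaLE frobD // mulrDr.
Qed.
Definition TA w : add_end V := AddEnd (Tmap_additive w).

Definition epsA (z : subvs_of E) : add_end V := @AddEnd V (fun x => z *: x) (scalerDr z).

Fact kapA_zmod : zmod_morphism kapA.
Proof.
move=> a b; apply: add_endP => x; apply: crdP => i.
have -> : (kapA a - kapA b) x = kapA a x - kapA b x by [].
apply: (addIr (crd (kapA b x) i)); rewrite -[in RHS]crdD subrK !crd_Kscale -mulrDl.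
by rewrite QXE -frobD // rmorphB subrK.
Qed.
HB.instance Definition _ := GRing.isZmodMorphism.Build _ _ kapA kapA_zmod.

Fact kapA_monoid : monoid_morphism kapA.
Proof.
split=> [|a b]; apply: add_endP => x; apply: crdP => i.
  by rewrite crd_Kscale /= algid1 expr1n mul1r.
by rewrite !add_end_mulE !crd_Kscale /= exprMn mulrA.
Qed.
HB.instance Definition _ := GRing.isMonoidMorphism.Build _ _ kapA kapA_monoid.

Lemma epsAM z z' : epsA (z * z') = epsA z * epsA z'.
Proof. by apply: add_endP => x; rewrite add_end_mulE /= scalerA. Qed.

Lemma epsA1 : epsA 1 = 1.
Proof. by apply: add_endP => x /=; rewrite scale1r. Qed.

Lemma epsA_kapA z a : epsA z * kapA a = kapA a * epsA z.
Proof.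
apply: add_endP => x; apply: crdP => i.
by rewrite !add_end_mulE crdZ !crd_Kscale crdZ mulrCA.
Qed.

Hypothesis gammaE : {in E, forall x : L, gammaL q s h c x = x}.
Hypothesis gammaK : {in K, forall x : L, gammaL q s h c x = x ^+ (Q ^ ell)}.

Lemma epsA_TA z w : epsA z * TA w = TA w * epsA z.
Proof.
apply: add_endP => x; apply: crdP => i.
rewrite !add_end_mulE crdZ !crd_Tmap crdZ; case: eqP => // _.
by rewrite gammaM (gammaE (subvsP z)) mulrCA.
Qed.

(** Away from the last coordinate [T] is a shift, which replaces the twist [Q ^ i] by [Q ^ i.+1]; at
    the wrap-around, [gammaK] supplies the twist [Q ^ ell]. *)
Lemma TA_kapA w a : TA w * kapA a = kapA (a ^+ Q) * TA w.
Proof.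
apply: add_endP => x; apply: crdP => i.
rewrite !add_end_mulE crd_Kscale !crd_Tmap crd_Kscale rmorphXn -exprM -expnS.
case: eqP => [ei|/eqP nei].
  by rewrite gammaM [(ordS i : nat)]/= ei modnn expr1 (gammaK (subvsP a)) mulrCA.
by rewrite [(ordS i : nat)]/= modn_small // ltn_neqAle nei ltn_ord.
Qed.

Hypothesis ell_gt0 : (0 < ell)%N.
Hypothesis gammaX : forall x : L, iter (n %/ ell) (gammaL q s h c) x = x.

Section IterT.
Variable w : L.
Local Notation wg := (fun z : L => w * gammaL q s h c z).

(* [x] extended to the sequence with [x_(i + ell) = w * gamma x_i], on which
   [Tmap] acts as the shift. *)
Definition crd_seq (x : V) (k : nat) : L :=
  iter (k %/ ell) wg (crd x (Ordinal (ltn_pmod k ell_gt0))).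

Lemma crd_seq_ord x (i : 'I_ell) : crd_seq x i = crd x i.
Proof.
rewrite /crd_seq divn_small //=; congr (crd x _); apply: val_inj.
by rewrite /= modn_small.
Qed.

Lemma crd_seq_Tmap x k : crd_seq (Tmap q h c w x) k = crd_seq x k.+1.
Proof.
rewrite /crd_seq crd_Tmap /=; set r := (k %% ell)%N.
have ltr : (r < ell)%N by rewrite ltn_pmod.
have ek : k = (k %/ ell * ell + r)%N by rewrite -divn_eq.
have [er|/eqP ner] := eqVneq r.+1 ell.
  have ek1 : k.+1 = ((k %/ ell).+1 * ell)%N by rewrite mulSn {1}ek -addnS er addnC.
  have -> : (k.+1 %/ ell = (k %/ ell).+1)%N by rewrite ek1 mulnK.
  rewrite iterSr; congr (iter _ _ (_ * gammaL _ _ _ _ (crd x _))).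
  by apply: val_inj; rewrite /= er modnn ek1 modnMl.
have ltr1 : (r.+1 < ell)%N by rewrite ltn_neqAle ltr andbT; apply/eqP.
have ek1 : k.+1 = (k %/ ell * ell + r.+1)%N by rewrite {1}ek addnS.
have -> : (k.+1 %/ ell = k %/ ell)%N by rewrite {1}ek1 divnMDl // (divn_small ltr1) addn0.
congr (iter _ _ (crd x _)).
by apply: val_inj; rewrite /= ek1 modnMDl.
Qed.

Lemma crd_iter_Tmap j x (i : 'I_ell) :
  crd (iter j (Tmap q h c w) x) i = crd_seq x (i + j).
Proof.
rewrite -crd_seq_ord; elim: j (i : nat) => [|j IHj] k; first by rewrite addn0.
by rewrite crd_seq_Tmap IHj addnS addSn.
Qed.

Lemma iter_wg j (z : L) : iter j wg z =
  (\prod_(i < j) iter i (gammaL q s h c) w) * iter j (gammaL q s h c) z.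
Proof.
elim: j => [|j IHj]; first by rewrite big_ord0 mul1r.
rewrite iterS IHj {1}/gammaL exprMn -prodrXl mulrA big_ord_recl.
by congr (_ * _ * _).
Qed.

(** A shift by [n] wraps around exactly [n %/ ell] times, each time applying [gamma] and multiplying
    by [w]. The factors collect into [u], and [gammaX] removes the powers of [gamma] on the
    coordinate. *)
Lemma TAn (u : subvs_of E) :
  vsval u = \prod_(i < n %/ ell) iter i (gammaL q s h c) w -> TA w ^+ n = epsA u.
Proof.
move=> uE; apply: add_endP => x; apply: crdP => i.
rewrite add_end_expE crd_iter_Tmap crdZ uE /crd_seq.
have -> : ((i + n) %/ ell = n %/ ell)%N.
  by rewrite divnDr ?dvdn_gcdl // divn_small.
rewrite iter_wg gammaX; congr (_ * crd x _); apply: val_inj.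
by rewrite /= -modnDmr (eqP (dvdn_gcdl n s)) addn0 modn_small.
Qed.

End IterT.
End CodeSpace.

(** * The cyclic algebra acting on the code space *)

Lemma big_ord_mul (R : Type) (idx : R) (op : Monoid.law idx) s n (F : nat -> R) :
  \big[op/idx]_(i < s * n) F i =
  \big[op/idx]_(j < s) \big[op/idx]_(r < n) F (j * n + r)%N.
Proof.
elim: s => [|s IHs]; first by rewrite mul0n !big_ord0.
by rewrite mulSnr big_split_ord IHs big_ord_recr.
Qed.

Lemma mul_inverse (A : pzRingType) (X X1 Y Y1 : A) :
  X * X1 = 1 -> Y * Y1 = 1 -> X * Y * (Y1 * X1) = 1.
Proof. by move=> XX1 YY1; rewrite mulrA -(mulrA X) YY1 mulr1. Qed.

Lemma conj_cancel (A : pzRingType) (X M M1 N N1 : A) :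
  M1 * M = 1 -> N * N1 = 1 -> M1 * (M * X * N) * N1 = X.
Proof. by move=> M1M NN1; rewrite -!mulrA NN1 mulr1 mulrA M1M mul1r. Qed.

Lemma conj_exp (A : pzRingType) (X M M1 : A) m : M * M1 = 1 -> M1 * M = 1 ->
  (M * X * M1) ^+ m = M * X ^+ m * M1.
Proof.
move=> MM1 M1M; elim: m => [|m IHm]; first by rewrite mulr1.
by rewrite exprS IHm !mulrA -(mulrA (M * X)) M1M mulr1 exprS !mulrA.
Qed.

Section Setting.
Variables (p e n s k : nat) (p_prime : prime p) (e_gt0 : (0 < e)%N).
Hypotheses (n_ge2 : (2 <= n)%N) (s_ge2 : (2 <= s)%N) (k_ge1 : (1 <= k)%N).
Hypothesis k_le : (k <= n - 1)%N.
Variables (L : splittingFieldType 'F_p) (Fq K E : {subfield L}).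
Hypotheses (dimFq : \dim Fq = e) (dimK : \dim K = (e * n)%N).
Hypothesis dimE : \dim E = (e * s)%N.
Hypothesis dimL : \dim {:L} = (e * (n * s %/ gcdn n s))%N.
Variables (sigma : gal_of K) (h : nat).
Hypothesis sigma_gen : generator 'Gal(K / Fq) sigma.
Hypothesis h_coprime : coprime h n.
Hypothesis sigmaE : {in K, forall a : L, sigma a = a ^+ ((p ^ e) ^ h)}.
Variables (c : nat) (c' : int).
Hypothesis c_bezout : (gcdn n s)%:Z = c%:Z * s%:Z + c' * n%:Z.
Hypothesis c_coprime : coprime c (n %/ gcdn n s).
Variables (F : {poly subvs_of Fq}) (w : L).
Hypotheses (F_irr : irreducible_poly F) (F_deg : size F = s.+1).
Hypothesis w_neq0 : w != 0.
Hypothesis u_root : root (map_poly vsval F) (galNorm E {:L} w).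

Local Notation q := (p ^ e)%N.
Local Notation ell := (gcdn n s).
Local Notation Q := (q ^ h)%N.
Local Notation V := (codeV E n s).
Local Notation gamma := (gammaL q s h c).
Local Notation n' := (n %/ ell)%N.

Lemma Fq_sub_K : (Fq <= K)%VS.
Proof. by apply: (@subfield_dvd _ p_prime _ _ _ n); rewrite dimFq. Qed.

Lemma Fq_sub_E : (Fq <= E)%VS.
Proof. by apply: (@subfield_dvd _ p_prime _ _ _ s); rewrite dimFq. Qed.

Lemma dim_FqK : \dim_Fq K = n.
Proof. by rewrite dimK dimFq mulKn. Qed.

Lemma ell_gt0 : (0 < ell)%N.
Proof. by rewrite gcdn_gt0; lia. Qed.

Lemma dimL_E : \dim {:L} = (\dim E * n')%N.
Proof. by rewrite dimL dimE -mulnA [(n * s)%N]mulnC -muln_divA ?dvdn_gcdl. Qed.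

Lemma dim_EL : \dim_E {:L} = n'.
Proof. by rewrite dimL_E mulKn // adim_gt0. Qed.

Lemma Q_mod i j : {in K, forall x : L, x ^+ (Q ^ i) = x ^+ (Q ^ j)} <->
  i = j %[mod n].
Proof. exact: (sigma_mod Fq_sub_K sigma_gen dim_FqK sigmaE). Qed.

Lemma gamma_E : {in E, forall x : L, gamma x = x}.
Proof.
move=> x xE; rewrite gammaLE -[RHS](exp_in_subfield p_prime (h * c) xE) dimE.
by congr (_ ^+ (_ ^ _)); lia.
Qed.

Lemma gamma_K : {in K, forall x : L, gamma x = x ^+ (Q ^ ell)}.
Proof.
move=> x xK; have -> : gamma x = x ^+ (Q ^ (c * s)).
  by rewrite /gammaL -[in RHS]expnM mulnA.
apply: (iffRL (Q_mod _ _)) => //.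
(* Bezout gives [c * s = ell] modulo [n]; the sign of [c'] decides on which side the multiple of [n]
   stands in [nat]. *)
case: c' c_bezout => m em.
  have -> : ell = (m * n + c * s)%N by lia.
  by rewrite modnMDl.
have -> : (c * s = m.+1 * n + ell)%N by lia.
by rewrite modnMDl.
Qed.

Lemma iter_gamma i (x : L) : iter i gamma x = x ^+ ((q ^ (h * c * s)) ^ i).
Proof.
by elim: i => [|i IHi]; rewrite ?expr1 //= IHi /gammaL -exprM -expnSr.
Qed.

Lemma gamma_n' (x : L) : iter n' gamma x = x.
Proof.
rewrite iter_gamma -[RHS](exp_in_subfield p_prime (h * c) (memvf x)) dimL_E dimE.
by rewrite -!expnM; congr (_ ^+ (_ ^ _)); lia.
Qed.

(** [gamma] is a power of the Frobenius of [L] over [E] with exponent [h * c], and both [h] and [c]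
    are prime to the degree [n']. *)
Lemma gamma_gen : exists2 g : gal_of {:L}, generator 'Gal({:L} / E) g &
  forall x : L, g x = gamma x.
Proof.
have [al gen_al alE] := finField_galois_generator (subvf E).
rewrite card_Fp // in alE.
exists (al ^+ (h * c))%g => [|x].
  rewrite (eqP gen_al) generator_coprime (order_sigma (subvf E) gen_al dim_EL).
  have n'n : (n' %| n)%N by apply/dvdnP; exists ell; rewrite mulnC divnK ?dvdn_gcdl.
  by rewrite coprimeMr ![coprime n' _]coprime_sym c_coprime (coprime_dvdr n'n).
rewrite (sigmaXE alE) ?memvf // /gammaL dimE; congr (_ ^+ _).
by rewrite -!expnM; congr (_ ^ _)%N; lia.
Qed.

Lemma galNorm_gamma x : galNorm E {:L} x = \prod_(i < n') iter i gamma x.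
Proof.
have [g gen_g gE] := gamma_gen.
rewrite (galNorm_sigma (subvf E) gen_g dim_EL (fun x _ => gE x)) ?memvf //.
by apply: eq_bigr => i _; rewrite iter_gamma.
Qed.

Let u := galNorm E {:L} w.

Lemma u_E : u \in E.
Proof. by rewrite mem_galNorm ?memvf //; apply: finField_galois; apply: subvf. Qed.

Lemma u_neq0 : u != 0.
Proof. by rewrite galNorm_eq0. Qed.

Definition uE : subvs_of E := vsproj E u.

Lemma val_uE : vsval uE = u.
Proof. by rewrite vsprojK ?u_E. Qed.

Lemma uE_neq0 : uE != 0.
Proof. by rewrite -(inj_eq val_inj) /= val_uE u_neq0. Qed.

Local Notation kap := (@kapA p e n s p_prime L K E h).
Local Notation eps := (@epsA p n s L E).
Local Notation T := (@TA p e n s p_prime L E h c w).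

(** The inverse of [T], because [T ^+ n] is multiplication by [u]. *)
Definition T1 := eps uE^-1 * T ^+ n.-1.

Lemma T_kap a : T * kap a = kap (a ^+ Q) * T.
Proof. exact: (TA_kapA p_prime E gamma_K). Qed.

Lemma eps_T z : eps z * T = T * eps z.
Proof. exact: (epsA_TA n p_prime gamma_E). Qed.

Lemma T_n : T ^+ n = eps uE.
Proof.
apply: (TAn p_prime ell_gt0 gamma_n'); rewrite val_uE; exact: galNorm_gamma.
Qed.

Lemma epsVK z : z != 0 -> eps z^-1 * eps z = 1.
Proof. by move=> z0; rewrite -epsAM mulVf // epsA1. Qed.

Lemma T_T1 : T * T1 = 1.
Proof.
rewrite mulrA -eps_T -mulrA -exprS prednK ?T_n ?epsVK ?uE_neq0 //; lia.
Qed.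

Lemma T1_T : T1 * T = 1.
Proof.
rewrite -mulrA -exprSr prednK ?T_n ?epsVK ?uE_neq0 //; lia.
Qed.

Lemma T1_n : T1 ^+ n = eps uE^-1.
Proof.
have := TnK T_T1 n (eps uE^-1); rewrite T_n epsVK ?uE_neq0 // mul1r.
by [].
Qed.

Lemma T_nj j : T ^+ (j * n) = eps (uE ^+ j).
Proof.
rewrite mulnC exprM T_n; elim: j => [|j IHj]; first by rewrite epsA1.
by rewrite !exprS epsAM IHj.
Qed.

Lemma eps_inj : injective eps.
Proof.
pose y : V := @vec p n s L E (fun=> 1).
move=> z z' /(congr1 (fun f : add_end V => crd (f y) (Ordinal ell_gt0))).
by rewrite !crdZ !crd_vec !mulr1 => /val_inj.
Qed.

Lemma Q_order_K i j :
  (forall a : subvs_of K, a ^+ (Q ^ i) = a ^+ (Q ^ j)) -> i = j %[mod n].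
Proof.
move=> eQ; apply/Q_mod => x xK; have /(congr1 vsval) := eQ (vsproj K x).
by rewrite !rmorphXn /= vsprojK.
Qed.

(** * Left independence over [K] of the powers of [T] below [s * n] *)

Local Notation ev := (skew_eval kap T).

(** Conjugation by [T ^+ m] turns the relation [f] into the relation [frob_poly Q m f]. Composing
    with [kap b] for all [b] in [K] separates the exponents by residue modulo [n], by Dedekind
    independence; inside one class, [T ^+ (j * n)] is multiplication by [u ^+ j]. *)
Lemma frob_eval_coord m r (f : {poly subvs_of K}) : (size f <= s * n)%N ->
  ev f = 0 -> (r < n)%N ->
  \sum_(j < s) vsval f`_(j * n + r) ^+ (Q ^ m) * u ^+ j = 0.
Proof.
move=> lef f0 ltr.
have fm0 : ev (frob_poly Q m f) = 0.
  have := Tn_skew_eval T_kap m f; rewrite f0 mulr0 skew_evalMXn.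
  by move/(congr1 (fun X => X * T1 ^+ m)); rewrite mul0r (TnK T_T1) => <-.
have fmE i : (frob_poly Q m f)`_i = f`_i ^+ (Q ^ m).
  rewrite coef_poly; case: ltnP => // lei; rewrite nth_default // expr0n.
  by rewrite !expn_eq0 -[p == 0%N]negbK -lt0n prime_gt0.
have szfm : (size (frob_poly Q m f) <= s * n)%N by rewrite size_frob_poly.
move: (frob_poly Q m f) fm0 fmE szfm => g g0 gE szg.
pose i0 := Ordinal ell_gt0; pose y : V := @vec p n s L E (fun=> 1).
(* Chosen so that [T ^+ (j * n + r)] sends [x] to [u ^+ j] times the all-one vector. *)
pose x := (T1 ^+ r) y.
have crd_kap0 a (v : V) : crd (kap a v) i0 = vsval a * crd v i0.
  by rewrite crd_Kscale expr1.
have Trx : (T ^+ r) x = y.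
  suff TT1r : T ^+ r * T1 ^+ r = 1 by rewrite -[LHS](add_end_mulE (T ^+ r)) TT1r.
  by have := TnK T_T1 r 1; rewrite mul1r.
pose G r := \sum_(j < s) vsval g`_(j * n + r) * crd ((T ^+ (j * n + r)) x) i0.
have G0 : forall b : L, b \in K -> \sum_(r < n) G r * b ^+ (Q ^ r) = 0.
  move=> b bK; pose b' := vsproj K b.
  have : crd ((ev g * kap b') x) i0 = 0 by rewrite g0 mul0r crd0.
  rewrite (skew_eval_wide _ _ szg) mulr_suml add_end_sumE crd_sum.
  rewrite (big_ord_mul _ _ _ (fun i => crd ((kap g`_i * T ^+ i * kap b') x) i0)).
  rewrite exchange_big => e0; rewrite -[RHS]e0; apply: eq_bigr => l _.
  rewrite mulr_suml; apply: eq_bigr => j _.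
  rewrite -(mulrA (kap _)) (Xn_kap _ T_kap) !add_end_mulE !crd_kap0 mulrAC -mulrA.
  congr (_ * (_ * _)); rewrite rmorphXn /= vsprojK //.
  by apply: (iffRL (Q_mod _ _)) => //; rewrite modnMDl.
rewrite -[RHS](sigma_independent Fq_sub_K sigma_gen dim_FqK sigmaE G0 ltr).
apply: eq_bigr => j _; rewrite gE rmorphXn /=; congr (_ * _).
by rewrite exprD add_end_mulE Trx T_nj crdZ crd_vec mulr1 rmorphXn /= val_uE.
Qed.

(** The powers of [u] may be dependent over [K], so one relation between the [a j] does not suffice.
    Weighting the conjugate relations by conjugates of [x] and summing yields a relation with
    coefficients [Tr(a j * x)] in [Fq], over which the powers of [u] are independent; nondegeneracy
    of the trace then gives [a j = 0]. *)
Lemma skew_eval_independent (f : {poly subvs_of K}) : (size f <= s * n)%N ->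
  ev f = 0 -> f = 0.
Proof.
move=> lef f0; apply/polyP => i; rewrite coef0.
have [lei|lti] := leqP (s * n) i; first by rewrite nth_default // (leq_trans lef).
have n_gt0 : (0 < n)%N by lia.
have ltr : (i %% n < n)%N by rewrite ltn_mod.
have ltj : (i %/ n < s)%N by rewrite ltn_divLR.
set r := (i %% n)%N in ltr; set j := (i %/ n)%N in ltj.
have -> : i = (j * n + r)%N by rewrite -divn_eq.
apply: val_inj; rewrite /=.
pose a j := vsval f`_(j * n + r).
have TrE (x : L) : x \in K -> \sum_(m < n) x ^+ (Q ^ m) \in Fq.
  move=> xK; rewrite -(galTrace_sigma Fq_sub_K sigma_gen dim_FqK sigmaE xK).
  exact: mem_galTrace (finField_galois Fq_sub_K) xK.
have Tr0 (x : L) : x \in K -> \sum_(m < n) (a j * x) ^+ (Q ^ m) = 0.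
  move=> xK.
  apply: (root_irreducible_independent (s := s)
    (f := fun j => \sum_(m < n) (a j * x) ^+ (Q ^ m)) F_irr u_root) ltj.
  - by rewrite F_deg.
  - by move=> l _; apply: TrE; rewrite rpredM ?subvsP.
  under eq_bigr => l _ do rewrite mulr_suml.
  rewrite exchange_big /= big1 // => m _.
  under eq_bigr => l _ do rewrite exprMn mulrAC.
  by rewrite -mulr_suml (frob_eval_coord m lef f0 ltr) mul0r.
rewrite -/(a j) -[a j]expr1.
apply: (sigma_independent Fq_sub_K sigma_gen dim_FqK sigmaE
  (f := fun m => a j ^+ (Q ^ m)) _ n_gt0) => x xK.
by rewrite -[RHS](Tr0 x xK); apply: eq_bigr => m _; rewrite exprMn.
Qed.

(** * Equivalences of the code and the set [HF] *)

Local Notation t := (s * k)%N.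
Local Notation mem_code := (in_code kap T t).

Lemma t_bounds : [/\ (2 <= t)%N, (t < s * n)%N & (t + s <= s * n)%N].
Proof.
have le : (s * k.+1 <= s * n)%N by rewrite leq_mul2l; lia.
have le2 : (s * 1 <= s * k)%N by rewrite leq_mul2l; lia.
by split; move: le le2; rewrite mulnS muln1; lia.
Qed.

Lemma kap_Fq lam : lam \in Fq -> kap (vsproj K lam) = eps (vsproj E lam).
Proof.
move=> lamF; apply: add_endP => x; apply: crdP => i.
rewrite crd_Kscale crdZ !vsprojK ?(subvP Fq_sub_K) ?(subvP Fq_sub_E) // QXE.
by rewrite -mulnA -dimFq exp_in_subfield.
Qed.

Lemma T1_kap : n = 2%N -> forall a, T1 * kap a = kap (a ^+ Q) * T1.
Proof.
move=> n2 a; rewrite /T1 (_ : n.-1 = 1%N) ?expr1; last by rewrite n2.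
by rewrite -mulrA T_kap !mulrA epsA_kapA.
Qed.

Lemma norm_mu (mu : subvs_of K) :
  vsval (\prod_(i < n) mu ^+ (Q ^ i)) = galNorm Fq K (vsval mu).
Proof.
rewrite (galNorm_sigma Fq_sub_K sigma_gen dim_FqK sigmaE (subvsP mu)).
by rewrite rmorph_prod; apply: eq_bigr => i _; rewrite rmorphXn.
Qed.

Lemma norm_mu_Fq (mu : subvs_of K) : galNorm Fq K (vsval mu) \in Fq.
Proof. by rewrite mem_galNorm ?subvsP //; apply: finField_galois Fq_sub_K. Qed.

Lemma kap_norm (mu : subvs_of K) : kap (\prod_(i < n) mu ^+ (Q ^ i)) =
  eps (vsproj E (galNorm Fq K (vsval mu))).
Proof.
rewrite -(kap_Fq (norm_mu_Fq mu)); congr (kap _); apply: val_inj.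
by rewrite [LHS]norm_mu /= vsprojK // (subvP Fq_sub_K) ?norm_mu_Fq.
Qed.

Lemma equivalence_HF (rho : gal_of E) M M1 N N1 :
  M * M1 = 1 -> M1 * M = 1 -> N * N1 = 1 -> N1 * N = 1 ->
  stabilizes kap T t M N -> stabilizes kap T t M1 N1 ->
  (forall z, M * eps z = eps (Defs.autE rho z) * M) -> HF Fq E n u rho.
Proof.
move=> MM1 M1M NN1 N1N sMN sM1N1 Meps.
have [t2 ltm let'] := t_bounds; have t0 : (0 < t)%N := ltnW t2.
have m0 : (0 < s * n)%N := leq_ltn_trans (leq0n _) ltm.
have thn : (M * T * M1) ^+ n = eps (Defs.autE rho uE).
  by rewrite (conj_exp _ _ MM1 M1M) T_n Meps -mulrA MM1 mulr1.
have HFP (mu : subvs_of K) z : eps (Defs.autE rho uE) =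
    eps (vsproj E (galNorm Fq K (vsval mu))) * eps z ->
    exists lam : L, [/\ lam \in Fq, lam != 0 & rho u = lam * vsval z].
  move=> /esym; rewrite -epsAM => /eps_inj /(congr1 vsval).
  rewrite Defs.autEK val_uE /= vsprojK ?(subvP Fq_sub_E) ?norm_mu_Fq // => eu.
  exists (galNorm Fq K (vsval mu)); split=> //; first exact: norm_mu_Fq.
  apply: contraNneq u_neq0 => l0; rewrite l0 mul0r in eu.
  by have /eqP := esym eu; rewrite fmorph_eq0.
case: (skew_equivalence T_T1 T_kap skew_eval_independent m0 t0 ltm Q_order_K
        MM1 M1M NN1 N1N sMN sM1N1 n_ge2 s_ge2 t2 erefl let') => [[b eb]|[n2 [b eb]]].
  have Tb : (kap b * T) ^+ n =
      eps (vsproj E (galNorm Fq K (vsval b))) * eps uE.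
    by rewrite (kap_Xn b n T_kap) T_n; congr (_ * _); exact: kap_norm.
  move: thn; rewrite eb Tb => /esym/HFP.
  rewrite val_uE /HF => Hp; case: ifP => _ //; by left.
have Tb : (kap b * T1) ^+ n =
    eps (vsproj E (galNorm Fq K (vsval b))) * eps uE^-1.
  by rewrite (kap_Xn b n (T1_kap n2)) T1_n; congr (_ * _); exact: kap_norm.
move: thn; rewrite eb Tb => /esym/HFP.
rewrite /HF n2 eqxx => Hm; right; move: Hm.
by rewrite /Hminus /= fmorphV /= val_uE.
Qed.

(** On [K], [gamma] is [sigma] iterated [ell] times, so the exponents [l + ell * j] with [l < ell]
    and [j < n'] run once through all [i < n] and rebuild the norm to [Fq]. The element [z] is fixed
    by [gamma] and occurs [ell * n' = n] times. *)
Lemma galNorm_twist (mu : subvs_of K) (z : subvs_of E) :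
  galNorm E {:L} (\prod_(l < ell) (vsval mu ^+ (Q ^ l) * vsval z)) =
  galNorm Fq K (vsval mu) * vsval z ^+ n.
Proof.
have en : n = (n' * ell)%N by rewrite divnK ?dvdn_gcdl.
rewrite galNorm_prod; under eq_bigr => l _ do rewrite galNormM galNormX.
rewrite big_split /=; congr (_ * _).
  rewrite (galNorm_sigma Fq_sub_K sigma_gen dim_FqK sigmaE (subvsP mu)).
  rewrite [in RHS]en (big_ord_mul _ _ _ (fun i => vsval mu ^+ (Q ^ i))).
  rewrite exchange_big; apply: eq_bigr => l _.
  rewrite galNorm_gamma -prodrXl; apply: eq_bigr => j _.
  rewrite expnD exprM; congr (_ ^+ _).
  elim: (j : nat) => [|m IHm]; first by rewrite expr1.
  rewrite iterS IHm gamma_K ?rpredX ?subvsP // -exprM -expnD.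
  by congr (_ ^+ (_ ^ _)); rewrite mulSn addnC.
rewrite prodr_const card_ord galNorm_gamma (eq_bigr (fun _ => vsval z)).
  by rewrite prodr_const card_ord -exprM -en.
move=> j _; elim: (j : nat) => [//|m IHm]; rewrite iterS IHm gamma_E //.
exact: subvsP.
Qed.

Lemma inverse_exp_subfield a : exists b, forall x : L,
  x ^+ (p ^ a) ^+ (p ^ b) = x.
Proof.
exists (a * (\dim {:L}).-1)%N => x; rewrite -exprM -expnD.
by rewrite mulnC -mulSn prednK ?adim_gt0 // exp_in_subfield ?memvf.
Qed.

(** [M] is the power [p ^ a] on each coordinate followed by the diagonal matrix [dd]. The relation
    with [T] is a recursion on [dd], solved by [d / D i]; closing the cycle at the last coordinate
    requires [P = d / gamma d]. Hilbert 90 provides [d], since the hypothesis on [u] says that [P]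
    has norm one. *)
Lemma exists_twist a (mu : subvs_of K) (z : subvs_of E) : mu != 0 -> z != 0 ->
  u ^+ (p ^ a) = galNorm Fq K (vsval mu) * vsval z ^+ n * u ->
  exists M M1, [/\ M * M1 = 1, M1 * M = 1,
    forall x, M * kap x = kap (x ^+ (p ^ a)) * M,
    forall x, M * eps x = eps (x ^+ (p ^ a)) * M
    & M * T = kap mu * (eps z * T) * M].
Proof.
move=> mu0 z0 eu.
have mu0' : vsval mu != 0 by rewrite fmorph_eq0.
have z0' : vsval z != 0 by rewrite fmorph_eq0.
have [D [D_0 DS DE D0]] : exists D : nat -> L, [/\ D 0%N = 1,
    forall i, D i.+1 = D i * (vsval mu ^+ (Q ^ i) * vsval z),
    D ell = \prod_(l < ell) (vsval mu ^+ (Q ^ l) * vsval z)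
    & forall i, D i != 0].
  exists (fun i => \prod_(l < i) (vsval mu ^+ (Q ^ l) * vsval z)).
  split=> // [|i|i]; first by rewrite big_ord0.
    by rewrite big_ord_recr.
  by apply/prodf_neq0 => l _; rewrite mulf_neq0 // expf_neq0.
pose P := D ell * w / w ^+ (p ^ a).
have wa0 : w ^+ (p ^ a) != 0 by rewrite expf_neq0.
have [g gen_g gE] := gamma_gen.
have : galNorm E {:L} P == 1.
  rewrite galNormM galNormV galNormX galNormM DE galNorm_twist -/u -eu mulfV //.
  by rewrite expf_neq0 ?u_neq0.
case/(Hilbert's_theorem_90 gen_g (memvf P)) => d [_ d0]; rewrite gE => ePd.
have gd0 : gamma d != 0 by rewrite expf_neq0.
have [dd ddD] : exists dd : nat -> L, forall i, dd i * D i = d.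
  by exists (fun i => d / D i) => i; rewrite divfK.
have dd0 i : dd i != 0 by apply: contraNneq d0 => e0; rewrite -(ddD i) e0 mul0r.
have [b abK] := inverse_exp_subfield a.
have baK (x : L) : x ^+ (p ^ b) ^+ (p ^ a) = x by rewrite exprAC abK.
pose fM (x : V) := @vec p n s L E (fun i => dd i * crd x i ^+ (p ^ a)).
pose fM1 (x : V) := @vec p n s L E (fun i => (crd x i / dd i) ^+ (p ^ b)).
have fME x i : crd (fM x) i = dd i * crd x i ^+ (p ^ a) by exact: crd_vec.
have fM1E x i : crd (fM1 x) i = (crd x i / dd i) ^+ (p ^ b) by exact: crd_vec.
have fMD : {morph fM : x y / x + y}.
  by move=> x y; apply: crdP => i; rewrite crdD !fME crdD frobD // mulrDr.
have fM1D : {morph fM1 : x y / x + y}.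
  by move=> x y; apply: crdP => i; rewrite crdD !fM1E crdD mulrDl frobD.
have [M ME] : exists M : add_end V, forall x i,
    crd (M x) i = dd i * crd x i ^+ (p ^ a) by exists (AddEnd fMD).
have [M1 M1E] : exists M1 : add_end V, forall x i,
    crd (M1 x) i = (crd x i / dd i) ^+ (p ^ b) by exists (AddEnd fM1D).
exists M, M1; split.
- apply: add_endP => x; apply: crdP => i.
  by rewrite add_end_mulE ME M1E baK mulrC divfK.
- apply: add_endP => x; apply: crdP => i.
  rewrite add_end_mulE M1E ME -[RHS]abK; congr (_ ^+ _).
  by rewrite mulrC; apply: mulKf (dd0 i) _.
- move=> x; apply: add_endP => y; apply: crdP => i.
  rewrite !add_end_mulE ME !crd_Kscale ME exprMn mulrCA rmorphXn.
  by rewrite exprAC.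
- move=> x; apply: add_endP => y; apply: crdP => i.
  by rewrite !add_end_mulE ME !crdZ ME exprMn mulrCA rmorphXn.
apply: add_endP => x; apply: crdP => i.
rewrite !add_end_mulE ME crd_Kscale crdZ !crd_Tmap ME.
have ddS : dd i = vsval mu ^+ (Q ^ i) * vsval z * dd i.+1.
  by apply: (mulIf (D0 i.+1)); rewrite -[RHS]mulrA ddD DS mulrA ddD mulrC.
case: eqP => [ei|/eqP nei].
  have e1 : D ell * w * gamma d = d * w ^+ (p ^ a).
    by apply/eqP; rewrite -eqr_div //; apply/eqP.
  have eD : dd ell * w ^+ (p ^ a) = w * gamma d.
    by apply: (mulIf (D0 ell)); rewrite mulrAC ddD -e1 -mulrA mulrC.
  have -> : dd (ordS i) = d by rewrite /= ei modnn -(ddD 0%N) D_0 mulr1.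
  rewrite gammaM ddS ei exprMn -!mulrA; congr (_ * (_ * _)).
  by rewrite !mulrA eD; congr (_ * _); rewrite /gammaL exprAC.
rewrite ddS -!mulrA [(ordS i : nat)]/= modn_small //.
by rewrite ltn_neqAle nei ltn_ord.
Qed.

(** * Linear maps over [E] inside the ring of additive maps *)

Lemma mem_code_eps X z : mem_code X -> X * eps z = eps z * X.
Proof.
case=> f _ ->; rewrite /skew_eval mulr_suml mulr_sumr; apply: eq_bigr => i _.
rewrite mulrA epsA_kapA -!mulrA; congr (_ * _); elim: (i : nat) => [|m IHm].
  by rewrite mul1r mulr1.
by rewrite exprS -mulrA IHm !mulrA eps_T.
Qed.

Definition endA (A : 'End(V)) : add_end V := AddEnd (linearD A).

Lemma endA_comp (A B : 'End(V)) : endA (A \o B)%VF = endA A * endA B.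
Proof. by apply: add_endP => x; rewrite add_end_mulE /= comp_lfunE. Qed.

Lemma codeP (A : 'End(V)) : code K E q n s h c k w A <-> mem_code (endA A).
Proof.
split=> [[alpha AE]|[f lef eA]].
  exists (\poly_(i < t) oapp alpha 0 (insub i)); first exact: size_poly.
  apply: add_endP => x; rewrite [LHS]AE skew_eval_poly add_end_sumE.
  by apply: eq_bigr => i _; rewrite valK add_end_mulE add_end_expE.
exists (fun i => f`_i) => x.
have -> : A x = endA A x by [].
rewrite eA (skew_eval_wide _ _ lef) add_end_sumE; apply: eq_bigr => i _.
by rewrite add_end_mulE add_end_expE.
Qed.

Lemma exists_endA X : (forall z, X * eps z = eps z * X) -> exists A, endA A = X.
Proof.
move=> Xeps; have linX : linear X.
  move=> z x y; rewrite add_endD; congr (_ + _).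
  by have /(congr1 (fun f : add_end V => f x)) := Xeps z; rewrite !add_end_mulE.
pose lX := GRing.isLinear.Build _ _ _ _ (X : V -> V) linX.
pose fX : {linear V -> V} := HB.pack (X : V -> V) lX.
by exists (linfun fX); apply: add_endP => x; exact: (lfunE fX x).
Qed.

Lemma mem_codeP X : mem_code X -> exists2 A, code K E q n s h c k w A & X = endA A.
Proof.
move=> XC; have [A eA] := exists_endA (fun z => mem_code_eps z XC).
by exists A => //; apply/codeP; rewrite eA.
Qed.

(** * Semilinear maps and the image of the projection *)

Variables (b : n.-tuple V) (bV : basis_of fullv b).
Local Notation C := (code K E q n s h c k w).

Definition semilinA (rho : gal_of E) : add_end V := AddEnd (semilinD b rho).

Lemma semilinA_eps rho z : semilinA rho * eps z = eps (Defs.autE rho z) * semilinA rho.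
Proof. by apply: add_endP => x; rewrite !add_end_mulE /= semilinZ. Qed.

Lemma semilinAM rho rho' : semilinA (rho' * rho)%g = semilinA rho * semilinA rho'.
Proof. by apply: add_endP => x; rewrite add_end_mulE /= semilin_comp. Qed.

Lemma semilinA1 : semilinA 1%g = 1.
Proof. by apply: add_endP => x /=; rewrite semilin1. Qed.

Lemma endA_twist rho A :
  endA (twist b rho A) = semilinA rho * endA A * semilinA rho^-1%g.
Proof. by apply: add_endP => x; rewrite !add_end_mulE /= twistE. Qed.

Lemma endA_eps A z : endA A * eps z = eps z * endA A.
Proof. by apply: add_endP => x; rewrite !add_end_mulE /= linearZ. Qed.

Lemma endA_gl (M : gl V) : endA M * endA (M^-1)%g = 1.
Proof. by apply: add_endP => x; rewrite add_end_mulE /= lker0_lfunVK ?gl_proof. Qed.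

Lemma endA_glV (M : gl V) : endA (M^-1)%g * endA M = 1.
Proof. by apply: add_endP => x; rewrite add_end_mulE /= lker0_lfunK ?gl_proof. Qed.

Lemma exists_gl (X X1 : add_end V) : X * X1 = 1 -> X1 * X = 1 ->
  (forall z, X * eps z = eps z * X) -> exists M : gl V, endA M = X.
Proof.
move=> XX1 X1X /exists_endA[A eA].
suff kA : lker A == 0%VS by exists (GL kA).
apply/lker0P => x y; have AE z : A z = X z by rewrite -eA.
by rewrite !AE => /(congr1 X1); rewrite -!add_end_mulE X1X.
Qed.

(** With [L_rho] absorbed on the right of the first factor and its inverse on the left of the
    second, a triple becomes a pair of semilinear maps and the basis disappears from the condition.
    The equality of codes splits into two inclusions, one for the pair and one for its inverse. *)
Lemma range_saut_projP rho : range (saut_proj bV C) rho <->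
  exists M M1 N N1, [/\ M * M1 = 1 /\ M1 * M = 1, N * N1 = 1 /\ N1 * N = 1,
    forall z, M * eps z = eps (Defs.autE rho z) * M,
    forall z, N1 * eps z = eps (Defs.autE rho z) * N1
    & stabilizes kap T t M N /\ stabilizes kap T t M1 N1].
Proof.
have semVr r : semilinA r * semilinA r^-1%g = 1.
  by rewrite -semilinAM mulVg semilinA1.
have semrV r : semilinA r^-1%g * semilinA r = 1.
  by rewrite -semilinAM mulgV semilinA1.
split=> [[g _ <-]|].
  have /asboolP gC := valP g; rewrite /saut_proj /=; set r := st_rho g.
  set PM := endA (st_M g); set PM1 := endA (st_M g)^-1%g.
  set PN := endA (st_N g); set PN1 := endA (st_N g)^-1%g.
  have actE A : endA (st_M g \o twist b r A \o st_N g)%VF =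
      PM * semilinA r * endA A * (semilinA r^-1%g * PN).
    by rewrite !endA_comp endA_twist -!mulrA.
  have MM1 : PM * semilinA r * (semilinA r^-1%g * PM1) = 1.
    by apply: mul_inverse (semVr r); apply: endA_gl.
  have M1M : semilinA r^-1%g * PM1 * (PM * semilinA r) = 1.
    by apply: mul_inverse (semrV r) _; apply: endA_glV.
  have NN1 : semilinA r^-1%g * PN * (PN1 * semilinA r) = 1.
    by apply: mul_inverse (semrV r) _; apply: endA_gl.
  have N1N : PN1 * semilinA r * (semilinA r^-1%g * PN) = 1.
    by apply: mul_inverse (semVr r); apply: endA_glV.
  exists (PM * semilinA r), (semilinA r^-1%g * PM1).
  exists (semilinA r^-1%g * PN), (PN1 * semilinA r).
  split=> // [z|z|].
  - by rewrite -mulrA semilinA_eps !mulrA endA_eps.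
  - by rewrite -mulrA semilinA_eps !mulrA endA_eps.
  split=> X /mem_codeP[A AC ->].
    have : sact (\val g) C (st_M g \o twist b r A \o st_N g)%VF by exists A.
    by rewrite gC -actE => gA; apply/codeP.
  have [B BC eB] : sact (\val g) C A by rewrite gC.
  have -> : endA A = PM * semilinA r * endA B * (semilinA r^-1%g * PN).
    by rewrite -actE -eB.
  by rewrite conj_cancel //; apply/codeP.
case=> M [M1 [N [N1 [[MM1 M1M] [NN1 N1N] Meps N1eps [sMN sM1N1]]]]].
have semV_eps z : semilinA rho^-1%g * eps (Defs.autE rho z) = eps z * semilinA rho^-1%g.
  by rewrite semilinA_eps -autE_comp mulgV autE_id.
have conj_eps X X1 z z' : X * X1 = 1 -> X1 * X = 1 -> X * eps z = eps z' * X ->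
    X1 * eps z' = eps z * X1.
  move=> XX1 X1X e1; rewrite -[LHS]mulr1 -XX1 mulrA -(mulrA X1) -e1 mulrA.
  by rewrite X1X mul1r.
(* Removing [L_rho] leaves maps that commute with [E], hence elements of [gl V]. *)
have [|||PM ePM] := @exists_gl (M * semilinA rho^-1%g) (semilinA rho * M1).
- by rewrite !mulrA -(mulrA M) semrV mulr1.
- by rewrite !mulrA -(mulrA _ M1) M1M mulr1 semVr.
- move=> z; rewrite -[LHS]mulrA semilinA_eps [LHS]mulrA Meps -autE_comp mulVg.
  by rewrite autE_id -mulrA.
have [|||PN ePN] := @exists_gl (semilinA rho * N) (N1 * semilinA rho^-1%g).
- by rewrite !mulrA -(mulrA _ N) NN1 mulr1 semVr.
- by rewrite !mulrA -(mulrA N1) semrV mulr1.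
- move=> z; rewrite -mulrA; have := N1eps (Defs.autE rho^-1%g z).
  rewrite -autE_comp mulVg autE_id => /(conj_eps _ _ _ _ N1N NN1) ->.
  by rewrite mulrA semilinA_eps -autE_comp mulVg autE_id mulrA.
have actE A : endA (PM \o twist b rho A \o PN)%VF = M * endA A * N.
  rewrite !endA_comp ePM ePN endA_twist !mulrA -(mulrA M) semrV mulr1.
  by rewrite -(mulrA _ (semilinA _^-1%g)) semrV mulr1.
have gC : `[< sact (SemiTriple bV PM PN rho) C = C >].
  apply/asboolP/seteqP; split=> [_ [A AC <-]|A AC] /=.
    by apply/codeP; rewrite actE; apply: sMN; apply/codeP.
  have [B BC eB] := mem_codeP (sM1N1 _ (iffLR (codeP A) AC)).
  exists B => //; apply/lfunP => x.
  suff : endA (PM \o twist b rho B \o PN)%VF = endA A.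
    by move/(congr1 (fun f : add_end V => f x)).
  by rewrite actE -eB -!mulrA N1N mulr1 mulrA MM1 mul1r.
by exists (SAut gC).
Qed.

Lemma range_saut_proj : range (saut_proj bV C) = HF Fq E n u.
Proof.
apply/seteqP; split=> rho.
  move=> /range_saut_projP[M [M1 [N [N1 [[MM1 M1M] [NN1 N1N] Me _ [s1 s2]]]]]].
  exact: (equivalence_HF MM1 M1M NN1 N1N s1 s2 Me).
move=> rhoH; apply/range_saut_projP.
have [t2 ltm _] := t_bounds; have t0 : (0 < t)%N := ltnW t2.
have m0 : (0 < s * n)%N := leq_ltn_trans (leq0n _) ltm.
have [a rhoE] := gal_of_frob p_prime rho.
have autEE z : Defs.autE rho z = z ^+ (p ^ a).
  by apply: val_inj; rewrite /= Defs.autEK rhoE ?subvsP // rmorphXn.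
have [b' abK] := inverse_exp_subfield a.
have baK (x : subvs_of K) : x ^+ (p ^ b') ^+ (p ^ a) = x.
  by apply: val_inj; rewrite /= !rmorphXn /= exprAC abK.
(* Serves both halves of [HF]: [z0 = 1] for [Hplus], and [z0 = u^-1] for [Hminus], where [n = 2]
   gives [lam * z0 ^+ 2 * u = lam * u^-1]. *)
have main z0 lam : z0 != 0 -> lam \in Fq -> lam != 0 ->
    rho u = lam * vsval z0 ^+ n * u ->
    exists M M1 mu, [/\ M * M1 = 1 /\ M1 * M = 1, mu != 0,
      forall x, M * kap x = kap (x ^+ (p ^ a)) * M,
      forall x, M1 * kap x = kap (x ^+ (p ^ b')) * M1
      & (forall z, M * eps z = eps (Defs.autE rho z) * M) /\
        M * T = kap mu * (eps z0 * T) * M].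
  move=> z00 lamF lam0 eu.
  have [mu muK eN] := galNorm_surj p_prime Fq_sub_K lamF lam0.
  have mu0 : vsproj K mu != 0.
    apply: contraNneq lam0 => /(congr1 vsval); rewrite /= vsprojK // => mu0.
    by rewrite -eN mu0 galNorm0.
  have [|M [M1 [MM1 M1M Mk Me MT]]] := @exists_twist a _ _ mu0 z00.
    by rewrite vsprojK // eN -rhoE ?u_E.
  exists M, M1, (vsproj K mu); split=> // [x|]; last first.
    by split=> // z; rewrite Me autEE.
  rewrite -[LHS]mulr1 -MM1 -{1}[x]baK mulrA -(mulrA M1) -Mk mulrA M1M.
  by rewrite mul1r.
have minvT X mu M M1 : mu != 0 -> M * M1 = 1 -> M1 * M = 1 ->
    (forall x, M1 * kap x = kap (x ^+ (p ^ b')) * M1) ->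
    M * T = kap mu * X * M -> M1 * X = kap (mu^-1 ^+ (p ^ b')) * T * M1.
  move=> mu0 MM1 M1M M1k MT.
  have -> : X = kap mu^-1 * M * T * M1.
    rewrite -(mulrA _ M T) MT !mulrA -rmorphM mulVf // rmorph1 mul1r.
    by rewrite -mulrA MM1 mulr1.
  by rewrite !mulrA M1k -(mulrA _ M1 M) M1M mulr1.
have plus : Hplus Fq u rho -> exists M M1 N N1, [/\ M * M1 = 1 /\ M1 * M = 1,
    N * N1 = 1 /\ N1 * N = 1, forall z, M * eps z = eps (Defs.autE rho z) * M,
    forall z, N1 * eps z = eps (Defs.autE rho z) * N1
    & stabilizes kap T t M N /\ stabilizes kap T t M1 N1].
  move=> [lam [lamF lam0 eu]].
  have [||||M [M1 [mu [[MM1 M1M] mu0 Mk M1k [Me MT]]]]] := main 1 lam.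
  - exact: oner_neq0.
  - exact: lamF.
  - exact: lam0.
  - by rewrite /= algid1 expr1n mulr1.
  rewrite epsA1 mul1r in MT.
  exists M, M1, M1, M; split=> //; split.
    exact: (stabilizes_conj T_kap MM1 Mk MT).
  exact: (stabilizes_conj T_kap M1M M1k (minvT _ _ _ _ mu0 MM1 M1M M1k MT)).
move: rhoH; rewrite /HF; case: eqP => [n2 [|]|_]; [exact: plus| |exact: plus].
move=> [lam [lamF lam0 eu]].
have T1E : T1 = eps uE^-1 * T by rewrite /T1 (_ : n.-1 = 1%N) ?expr1 // n2.
have [||||M [M1 [mu [[MM1 M1M] mu0 Mk M1k [Me MT]]]]] := main uE^-1 lam.
- by rewrite invr_eq0 uE_neq0.
- exact: lamF.
- exact: lam0.
- rewrite eu fmorphV /= val_uE n2 -mulrA; congr (_ * _).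
  by rewrite expr2 -mulrA mulVf ?mulr1 ?u_neq0.
rewrite -T1E in MT.
have k1 := T1_kap n2.
(* Conjugation by [M] inverts [T] up to a scalar, hence so does conjugation by [M1]; its scalar is
   [mu] carried across [M1] and [T1]. *)
have M1T : M1 * T = kap ((mu ^+ (p ^ b')) ^+ Q) * T1 * M1.
  have MT' : M1 * kap mu * T1 = T * M1.
    have -> : T * M1 = M1 * (M * T) * M1 by rewrite !mulrA M1M mul1r.
    by rewrite MT !mulrA -(mulrA _ M) MM1 mulr1.
  have -> : M1 * T = T1 * (T * M1) * T.
    by rewrite mulrA T1_T mul1r.
  rewrite -MT' -[_ * T]mulrA -(mulrA _ T1) T1_T mulr1 M1k mulrA k1.
  by [].
have Tt m : T ^+ m * T1 ^+ m = 1 by have := TnK T_T1 m 1; rewrite mul1r.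
have T1t m : T1 ^+ m * T ^+ m = 1 by have := TnK T1_T m 1; rewrite mul1r.
exists M, M1, (M1 * T ^+ t.-1), (T1 ^+ t.-1 * M); split=> //.
- split; last by rewrite mulrA -(mulrA _ M) MM1 mulr1 T1t.
  by rewrite mulrA -(mulrA M1) Tt mulr1 M1M.
- move=> z; rewrite -mulrA Me !mulrA; congr (_ * _).
  have eT1 : T1 * eps (Defs.autE rho z) = eps (Defs.autE rho z) * T1.
    by rewrite T1E -mulrA -eps_T !mulrA -!epsAM mulrC.
  elim: (t.-1) => [|m IHm]; first by rewrite mul1r mulr1.
  by rewrite exprS -[LHS]mulrA IHm [LHS]mulrA eT1 -mulrA.
split; first exact: (stabilizes_conj_inv T1_T m0 t0 ltm MM1 Mk MT k1).
move=> X XC.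
exact: (stabilizes_conj_inv' T1_T T_kap m0 t0 ltm M1M mu0 M1k MT M1T k1 XC).
Qed.

End Setting.

(** * The kernel of the projection and the exact sequence *)

Section SautExact.
Variables (F0 : fieldType) (L : splittingFieldType F0) (E : {subfield L}).
Variables (V : vectType (subvs_of E)) (n : nat) (b : n.-tuple V).
Variables (bV : basis_of fullv b) (C : set 'End(V)).
Local Notation pi := (saut_proj bV C).
Local Notation iota := (saut_incl bV C).

Lemma saut_projM (g g' : saut bV C) : pi (g * g')%g = (pi g' * pi g)%g.
Proof. by []. Qed.

Lemma saut_incl_inj : injective iota.
Proof.
move=> g g' /(congr1 val) [eM eN]; apply: val_inj; apply: (can_inj (@glpairK _ _)).
by rewrite /= eM eN.
Qed.

Lemma range_saut_incl : range iota = [set g | pi g = 1%g].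
Proof.
apply/seteqP; split=> [_ [g _ <-] //|g /= pg].
have /asboolP gC := valP g.
have lC : `[< lact (GLPair (st_M g) (st_N g)) C = C >].
  apply/asboolP; apply: etrans gC; apply: eq_imagel => A _.
  by move: pg; rewrite /saut_proj => ->; rewrite twist1.
exists (LAut lC) => //; apply: val_inj; apply: (can_inj (@semitripleK _ _ _ _ _ _ _)).
by rewrite /= -pg.
Qed.

Hypothesis gal_of_comm : forall rho rho' : gal_of E, (rho * rho' = rho' * rho)%g.

(** The last term of the sequence must be a group type, so the image of [pi] is made a
    [{group gal_of E}] and [pi] is corestricted to [subg_of] it. *)
Lemma saut_proj_exact : exists (HG : {group gal_of E})
    (piH : {multiplicative saut bV C -> subg_of HG}),
  [/\ [set rho | rho \in HG] = range pi,
      (forall g, sgval (piH g) = pi g)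
    & short_exact iota piH].
Proof.
pose G := finset (fun rho => `[< range pi rho >]).
have GE rho : rho \in G <-> range pi rho by rewrite inE; split=> /asboolP.
have gG : group_set G.
  apply/group_setP; split; first by apply/GE; exists 1%g.
  move=> _ _ /GE[g _ <-] /GE[g' _ <-]; apply/GE.
  by exists (g * g')%g => //; rewrite saut_projM gal_of_comm.
pose HG := Group gG.
have piG g : pi g \in HG by apply/GE; exists g.
pose f g : subg_of HG := subg HG (pi g).
have fE g : sgval (f g) = pi g by rewrite subgK.
have f1 : f 1%g = 1%g by apply: val_inj; rewrite /= fE.
have fM : {morph f : g g' / (g * g')%g}.
  by move=> g g'; apply: val_inj; rewrite /= !fE saut_projM gal_of_comm.
pose fmM := isUMagmaMorphism.Build _ _ f (conj f1 fM).
pose piH : {multiplicative saut bV C -> subg_of HG} := HB.pack f fmM.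
exists HG, piH; split=> //; first by apply/seteqP; split=> rho /GE.
split; first exact: saut_incl_inj.
  rewrite range_saut_incl; apply/seteqP; split=> g /= pg.
    by apply: val_inj; rewrite /= fE.
  by rewrite -fE pg.
apply/seteqP; split=> // rho _; have /GE[g _ eg] := subgP rho.
by exists g => //; apply: val_inj; rewrite /= fE.
Qed.

End SautExact.

Theorem theorem6p11
  (p e q n s k : nat) (p_prime : prime p) (e_gt0 : (0 < e)%N)
  (q_def : q = (p ^ e)%N)
  (n_ge2 : (2 <= n)%N) (s_ge2 : (2 <= s)%N) (k_ge1 : (1 <= k)%N)
  (k_le : (k <= n - 1)%N)
  (L : splittingFieldType 'F_p) (Fq K E : {subfield L})
  (dimFq : \dim Fq = e) (dimK : \dim K = (e * n)%N)
  (dimE : \dim E = (e * s)%N)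
  (dimL : \dim {:L} = (e * (n * s %/ gcdn n s))%N)
  (sigma : gal_of K) (sigma_gen : generator 'Gal(K / Fq) sigma)
  (h : nat) (h_coprime : coprime h n)
  (sigmaE : {in K, forall a : L, sigma a = a ^+ (q ^ h)})
  (c : nat) (c' : int) (c_gt0 : (0 < c)%N)
  (c_bezout : (gcdn n s)%:Z = c%:Z * s%:Z + c' * n%:Z)
  (c_coprime : coprime c (n %/ gcdn n s))
  (F : {poly subvs_of Fq}) (F_monic : F \is monic)
  (F_irr : irreducible_poly F) (F_deg : size F = s.+1)
  (w : L) (w_neq0 : w != 0)
  (u_root : root (map_poly vsval F) (galNorm E {:L} w))
  (b : n.-tuple (codeV E n s)) (bV : basis_of fullv b) :
  let C := code K E q n s h c k w in
  let pi := saut_proj bV C in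
  let iota := saut_incl bV C in
  let H := HF Fq E n (galNorm E {:L} w) in
  [/\ {morph pi : g g' / (g * g')%g},
      range pi = H,
      [/\ {morph iota : g g' / (g * g')%g}, injective iota
        & range iota = [set g | pi g = 1%g]]
    & exists (HG : {group gal_of E})
             (piH : {multiplicative saut bV C -> subg_of HG}),
        [/\ [set rho | rho \in HG] = H,
            (forall g, sgval (piH g) = pi g)
          & short_exact iota piH]].
Proof.
move=> C pi iota H; rewrite {}q_def in sigmaE C pi iota H *.
have piE : range pi = H.
  exact: (range_saut_proj p_prime e_gt0 n_ge2 s_ge2 k_ge1 k_le dimFq dimK dimE
    dimL sigma_gen h_coprime sigmaE c_bezout c_coprime F_irr F_deg w_neq0
    u_root bV).
have comm := @gal_of_commute _ p_prime _ E.
split=> //; first by move=> g g'; rewrite [LHS]saut_projM comm.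
  split; [exact: saut_inclM | exact: saut_incl_inj | exact: range_saut_incl].
by rewrite -piE; apply: saut_proj_exact.
Qed.
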